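(* Every instance of fair allocation of goods with additive valuations having $n \ge 8$ agents and $m = n + 7$ goods admits an MMS allocation.
   Context: An instance of fair allocation of goods consists of a set $N=\{1,\dots,n\}$ of agents, a set $M=\{1,\dots,m\}$ of goods, and for each agent $i$ an additive valuation $v_i:2^M\to\mathbb{R}$ with $v_i(\emptyset)=0$, $v_i(S)=\sum_{g\in S}v_i(\{g\})$ and $v_i(\{g\})\ge 0$. An allocation is an ordered $n$-tuple $\langle A_1,\dots,A_n\rangle$ of pairwise disjoint (possibly empty) subsets of $M$ with union $M$. The maximin share of agent $i$ is $\mu_i=\max_{A}\min_{j} v_i(A_j)$ over all allocations $A$. An MMS allocation is an allocation with $v_i(A_i)\ge\mu_i$ for all $i$. *)

(* Defs.v *)
From mathcomp Require Import all_boot all_order all_algebra.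
Set Implicit Arguments. Unset Strict Implicit. Unset Printing Implicit Defensive.
Import Order.TTheory GRing.Theory Num.Theory.
Local Open Scope ring_scope.

(* an allocation <A_1,...,A_n> (pairwise disjoint bundles covering M) is
   represented by the owner function A : {ffun 'I_m -> 'I_n};
   bundle A j = A_j. *)
Definition bundle (n m : nat) (A : {ffun 'I_m -> 'I_n}) (j : 'I_n) : {set 'I_m} :=
  [set g | A g == j].

Definition val (R : realFieldType) (n m : nat) (v : 'I_n -> 'I_m -> R)
  (i : 'I_n) (S : {set 'I_m}) : R := \sum_(g in S) v i g.

(* min_j v_i(A_j); the seed v_i(M) is >= every v_i(A_j) (nonnegative values),
   so for n >= 1 this is exactly the minimum. *)
Definition min_bundle_val (R : realFieldType) (n m : nat) (v : 'I_n -> 'I_m -> R)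
  (i : 'I_n) (A : {ffun 'I_m -> 'I_n}) : R :=
  \big[Num.min/val v i setT]_(j : 'I_n) val v i (bundle A j).

(* maximin share mu_i = max_A min_j v_i(A_j); the seed 0 is <= every candidate
   (nonnegative values), so for n >= 1 this is exactly the maximum. *)
Definition mms (R : realFieldType) (n m : nat) (v : 'I_n -> 'I_m -> R)
  (i : 'I_n) : R :=
  \big[Num.max/0]_(A : {ffun 'I_m -> 'I_n}) min_bundle_val v i A.

Definition is_MMS_allocation (R : realFieldType) (n m : nat)
  (v : 'I_n -> 'I_m -> R) (A : {ffun 'I_m -> 'I_n}) : Prop :=
  forall i : 'I_n, mms v i <= val v i (bundle A i).

(* Main.v *)
(* After scaling, every maximin share is 1, and a picking sequence reduces the problem to agents
   that all rank the goods in the same order.  There one shows, for suitable (r, N, c), that among N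
   agents who can each split the same r + c goods into r bundles they like (worth at least 1 to
   them), some r can be served simultaneously; the theorem is the case (n, n, 7).

   A bundle liked by one agent is given away whenever enough other agents can still split the rest
   into r - 1 liked bundles; for a single good this is always so.  If nobody likes a single good,
   every bundle has at least two goods and hence many have exactly two.  Every liked pair contains
   one of the r - 1 best goods, and only few agents can own a pair with a given best element, for
   removing the pair with the worst partner keeps the others' cuts alive; this bounds the number of
   pairs.  Counting leaves r = 3 with 9 or 10 goods, where the triples of different agents meet
   almost like the lines of a plane, and r = 4 with 11 goods, where seven agents own two disjoint
   triples that the six others dislike.  By domination these triples would occupy fourteen chains in
   a poset that is a union of thirteen. *)

Require Import Defs.
From mathcomp Require Import all_boot all_order all_fingroup all_algebra.
From mathcomp Require Import zify lra.
From Stdlib Require Import Classical_Prop.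

Import Order.TTheory GRing.Theory Num.Theory.
Set Implicit Arguments. Unset Strict Implicit. Unset Printing Implicit Defensive.

(** In (r, N, c), c is the surplus of goods over bundles. Giving away a single good keeps c, giving
    away a pair lowers it by one; either way an agent leaves. This is the obstacle: at surplus 7 a
    single good would lead from eight agents to seven. If at least r agents like the best good, it
    is set aside instead, the other r - 1 bundles are found without losing anybody, and some liker
    is still unserved. If fewer like it, at least 9 - r of eight agents dislike every single good.
    For r = 5 and 6 the bundles of these agents are mostly pairs, and this persists while single
    goods disappear, until there are more pairs than the bound permits. For r = 4 each of them keeps
    one triple more than the likers do, which is enough to break the bound valid for three
    bundles. *)

Ltac slia := intros; unfold reverse_coercion in *; lia.

(** * Worth, cuts, and goods whose removal leaves a cut *)

Section Allocations.
Variables (R : realFieldType) (I : finType) (m : nat) (v : I -> 'I_m -> R).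
Hypothesis v_ge0 : forall i g, (0 <= v i g)%R.
Hypothesis v_anti : forall i (g h : 'I_m), g <= h -> (v i h <= v i g)%R.

Implicit Types (i j l : I) (A X Y : {set I}) (g h x y z : 'I_m)
  (S T U V Z Q : {set 'I_m}).

Definition worth i S : R := (\sum_(g in S) v i g)%R.
Definition likes i S : bool := (1 <= worth i S)%R.
Definition bun k (f : {ffun 'I_m -> 'I_k}) U b := [set g in U | f g == b].
Definition cutby i k U (f : {ffun 'I_m -> 'I_k}) := [forall b, likes i (bun f U b)].
Definition cut i k U := [exists f : {ffun 'I_m -> 'I_k}, cutby i U f].
(** Goods that [a] sends outside [A] are simply left over, so no partition has to be maintained and
    a solution survives enlarging [X] or [U]. *)
Definition solv k X U := exists (A : {set I}) (a : 'I_m -> I),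
  [/\ A \subset X, #|A| = k & forall i, i \in A -> likes i [set g in U | a g == i]].

Lemma cutP i k U :
  reflect (exists f : {ffun 'I_m -> 'I_k}, forall b, likes i (bun f U b)) (cut i k U).
Proof.
rewrite /cut; apply: (iffP existsP) => [[f /forallP H]|[f H]]; exists f => //.
exact/forallP.
Qed.

Lemma worthS i S U : S \subset U -> (worth i S <= worth i U)%R.
Proof.
move=> sSU; rewrite /worth [leRHS](big_setID S) /= (setIidPr sSU) lerDl.
by apply: sumr_ge0 => g _.
Qed.

Lemma worthU i S U : [disjoint S & U] -> worth i (S :|: U) = (worth i S + worth i U)%R.
Proof. by move=> d; rewrite /worth (eq_bigl [predU S & U]) ?bigU //= => g; rewrite !inE. Qed.

Lemma worthD i S U : S \subset U -> worth i (U :\: S) = (worth i U - worth i S)%R.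
Proof.
move=> sSU; rewrite /worth [in RHS](big_setID S) /= (setIidPr sSU); lra.
Qed.

Lemma worthU_le i S U : (worth i (S :|: U) <= worth i S + worth i U)%R.
Proof.
have -> : S :|: U = S :|: (U :\: S) by apply/setP=> g; rewrite !inE; case: (g \in S).
rewrite worthU ?lerD2l ?worthS ?subsetDl //.
by rewrite disjoint_sym disjoints_subset; apply/subsetP=> g; rewrite !inE => /andP[].
Qed.

Lemma likesS i S U : S \subset U -> likes i S -> likes i U.
Proof. by move=> /(worthS i) le1; rewrite /likes => /le_trans; apply. Qed.

Lemma dislikeE i S : ~~ likes i S -> (worth i S < 1)%R.
Proof. by rewrite /likes -ltNge. Qed.

Lemma bunS k (f : {ffun 'I_m -> 'I_k}) U b : bun f U b \subset U.
Proof. by apply/subsetP=> g; rewrite inE => /andP[]. Qed.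

Lemma bun_disj k (f : {ffun 'I_m -> 'I_k}) U b c : b != c ->
  [disjoint bun f U b & bun f U c].
Proof.
move=> bc; rewrite disjoints_subset; apply/subsetP=> g; rewrite !inE.
by case/andP=> -> /eqP ->.
Qed.

Lemma worth_bun i k (f : {ffun 'I_m -> 'I_k}) U :
  worth i U = (\sum_b worth i (bun f U b))%R.
Proof.
rewrite /worth (partition_big f predT) //=; apply: eq_bigr => b _.
by apply: eq_bigl => g; rewrite inE.
Qed.

Lemma card_bun k (f : {ffun 'I_m -> 'I_k}) U : #|U| = \sum_b #|bun f U b|.
Proof.
rewrite -sum1_card (partition_big f predT) //=; apply: eq_bigr => b _.
by rewrite -sum1_card; apply: eq_bigl => g; rewrite inE.
Qed.

Lemma card_bunI k (f : {ffun 'I_m -> 'I_k}) U S : S \subset U ->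
  #|S| = \sum_b #|S :&: bun f U b|.
Proof.
move=> sSU; rewrite (card_bun f S); apply: eq_bigr => b _; apply: eq_card => g.
by rewrite !inE; case gS: (g \in S) => //=; rewrite (subsetP sSU).
Qed.

Lemma cut_worth i k U : cut i k U -> (k%:R <= worth i U)%R.
Proof.
case/cutP=> f H; rewrite (worth_bun i f).
apply: le_trans (ler_sum _ (fun b _ => H b)); by rewrite sumr_const card_ord.
Qed.

Lemma cutS i k U V : cut i k U -> U \subset V -> cut i k V.
Proof.
case/cutP=> f H sUV; apply/cutP; exists f => b; apply: likesS (H b).
by apply/subsetP=> g; rewrite !inE => /andP[/(subsetP sUV)-> ->].
Qed.

(* A bundle may be discarded; its goods become available for any use. *)
Lemma cut_drop i k U V (f : {ffun 'I_m -> 'I_k.+2}) b :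
  (forall c, c != b -> likes i (bun f U c)) -> U :\: bun f U b \subset V -> cut i k.+1 V.
Proof.
move=> H sV; apply/cutP; exists [ffun g => odflt ord0 (unlift b (f g))] => c.
apply: likesS (H (lift b c) _); last by rewrite eq_sym neq_lift.
apply/subsetP=> g; rewrite !inE ffunE => /andP[gU /eqP fg].
rewrite fg liftK eqxx andbT; apply: (subsetP sV).
by rewrite !inE gU fg eq_sym neq_lift.
Qed.

(** The transposition of [x] and [z] carries the bundles over, and the bundle that held [x] can only
    gain: the smaller index is the better good. *)
Lemma cut_exch i k U x z : cut i k U -> z <= x -> (z \notin U) || (z == x) ->
  cut i k (z |: (U :\ x)).
Proof.
case/cutP=> f H lezx zU.
have [->|nzx] := eqVneq z x.
  by apply: (@cutS _ _ U); [apply/cutP; exists f | apply/subsetP=> g; rewrite !inE; case: eqP].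
rewrite (negPf nzx) orbF in zU.
have [xU|xU] := boolP (x \in U); last first.
  apply: (@cutS _ _ U); first by apply/cutP; exists f.
  apply/subsetP=> g gU; rewrite !inE gU andbT.
  by rewrite (contraNneq _ xU) ?orbT // => <-.
apply/cutP; exists [ffun g => f (tperm x z g)] => b.
apply: le_trans (H b) _.
have -> : bun [ffun g => f (tperm x z g)] (z |: U :\ x) b = tperm x z @: bun f U b.
  apply/setP=> g; rewrite -{2}(tpermK x z g) (mem_imset _ _ perm_inj) !inE ffunE.
  case: tpermP => [->|->|/eqP gx /eqP gz].
  - by rewrite eqxx eq_sym (negPf nzx) (negPf zU).
  - by rewrite eqxx xU.
  - by rewrite (negPf gz) gx.
rewrite /worth [leRHS]big_imset /=; last by move=> ? ? _ _; apply: perm_inj.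
apply: ler_sum => g; rewrite !inE => /andP[gU _].
case: tpermP => [->|gz|//]; first exact: v_anti.
by move: zU; rewrite -gz gU.
Qed.

(* Goods of T outside Q are at least as good as those of Q, so a bundle with
   #|Q| goods of T can be traded for Q. *)
Lemma cut_pigeon i k U T Q (f : {ffun 'I_m -> 'I_k.+2}) b :
  (forall c, c != b -> likes i (bun f U c)) -> T \subset U -> Q \subset T ->
  (forall z x, z \in T :\: Q -> x \in Q -> z <= x) ->
  #|Q| <= #|bun f U b :&: T| -> cut i k.+1 (U :\: Q).
Proof.
move=> H sTU sQT better leQ.
set B := bun f U b.
have: cut i k.+1 (U :\: B) by apply: cut_drop H _.
have [n] := ubnP #|Q :\: B|.
have sBU : B \subset U by apply: bunS.
move: leQ sBU; rewrite -/B; clearbody B => {H}.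
elim: n B => // n IH B leQ sBU ltn cutB.
have [QB|[x]] := set_0Vmem (Q :\: B).
  apply: cutS cutB _; apply: setDS.
  by apply/subsetP=> g gQ; apply: contraT => gB; have := in_set0 g; rewrite -QB inE gB gQ.
rewrite inE => /andP[xB xQ].
have [z] : exists z, z \in (B :&: T) :\: Q.
  apply/set0Pn; apply/eqP => E0.
  have sBQ : B :&: T \subset Q by rewrite -setD_eq0 E0.
  have /eqP BQ : B :&: T == Q by rewrite eqEcard sBQ.
  by move: xQ; rewrite -BQ inE (negPf xB).
rewrite !inE => /and3P[zQ zB zT].
apply: (IH (x |: (B :\ z))).
- have xz : x != z by apply: contraNneq zQ => <-.
  have -> : (x |: B :\ z) :&: T = x |: ((B :&: T) :\ z).
    apply/setP=> g; rewrite !inE; case: eqP => [->|_] /=; first by rewrite (subsetP sQT).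
    by rewrite andbA.
  rewrite cardsU1 !inE (negPf xB) andbF add1n.
  by have := cardsD1 z (B :&: T); rewrite inE zB zT /= => E; rewrite -add1n -E.
- apply/subsetP=> g; rewrite !inE => /orP[/eqP->|/andP[_ /(subsetP sBU)//]].
  exact: (subsetP sTU _ (subsetP sQT _ xQ)).
- have : Q :\: (x |: B :\ z) \subset (Q :\: B) :\ x.
    apply/subsetP=> g; rewrite !inE negb_or negb_and negbK => /andP[/andP[-> /=]].
    by case: eqP => [->|_ /= -> ->]; rewrite ?(negPf zQ).
  move/subset_leq_card => le1; have := cardsD1 x (Q :\: B); rewrite inE xB xQ /= add1n => E.
  by move: ltn; rewrite E ltnS; apply: leq_ltn_trans.
- have := @cut_exch i k.+1 (U :\: B) x z cutB.
  rewrite better ?inE ?zQ ?zT // zB /= => /(_ isT isT) /cutS; apply.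
  apply/subsetP=> g; rewrite !inE => /orP[/eqP->|/and3P[gx gB ->]].
    by rewrite eqxx (subsetP sBU _ zB) /= orbF andbT; apply: contraNneq xB => <-.
  by rewrite (negPf gx) (negPf gB) andbF.
Qed.

(** Two bundles are together worth at least 2 and a disliked [Z] takes less than 1 out of them, so
    their remains merge into one liked bundle. *)
Lemma cut_dislike i k U Z (f : {ffun 'I_m -> 'I_k.+2}) b c :
  (forall d, likes i (bun f U d)) -> Z \subset bun f U b :|: bun f U c ->
  ~~ likes i Z -> cut i k.+1 (U :\: Z).
Proof.
move=> H sZ nZ; have [bc|nbc] := eqVneq b c.
  apply: (@cut_drop _ _ U _ f b) => [d _|]; first exact: H.
  by apply: setDS; rewrite bc setUid in sZ *.
pose f' := [ffun g => if f g == c then b else f g].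
have Ec : bun f' (U :\: Z) c = set0.
  apply/setP=> g; rewrite !inE ffunE; case: (eqVneq (f g) c) => [_|/negPf->]; last by rewrite andbF.
  by rewrite (negPf nbc) andbF.
apply: (@cut_drop _ _ (U :\: Z) _ f' c); last by rewrite Ec setD0.
move=> d dc; have [->|db] := eqVneq d b; last first.
  apply: likesS (H d); apply/subsetP=> g; rewrite !inE ffunE => /andP[gU /eqP fg].
  rewrite gU fg (negPf dc) eqxx !andbT; apply/negP=> /(subsetP sZ).
  by rewrite !inE fg (negPf db) (negPf dc) !andbF.
have -> : bun f' (U :\: Z) b = (bun f U b :|: bun f U c) :\: Z.
  apply/setP=> g; rewrite !inE ffunE; case: (g \in Z) => //=; case: (g \in U) => //=.
  by case: (eqVneq (f g) c) => [_|_]; rewrite ?eqxx ?orbT ?orbF.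
rewrite /likes worthD // worthU ?bun_disj //.
have := H b; have := H c; have := dislikeE nZ; rewrite /likes; lra.
Qed.

Lemma cut_dislike2 i k U Z : cut i k.+2 U -> #|Z| <= 2 -> Z \subset U ->
  ~~ likes i Z -> cut i k.+1 (U :\: Z).
Proof.
case/cutP=> f H le2 sZU nZ.
have [b [c sZ]] : exists b c, Z \subset bun f U b :|: bun f U c.
  have [->|[x xZ]] := set_0Vmem Z; first by exists ord0, ord0; apply: sub0set.
  have [Zx|[y]] := set_0Vmem (Z :\ x).
    exists (f x), (f x); apply/subsetP=> g gZ; rewrite !inE (subsetP sZU) //=.
    have [->|gx] := eqVneq g x; first by rewrite eqxx.
    by have := in_set0 g; rewrite -Zx !inE gx gZ.
  rewrite !inE => /andP[yx yZ]; exists (f x), (f y); apply/subsetP=> g gZ.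
  rewrite !inE (subsetP sZU) //=.
  have [->|gx] := eqVneq g x; first by rewrite eqxx.
  have [->|gy] := eqVneq g y; first by rewrite eqxx orbT.
  have := subset_leq_card (_ : [set x; y; g] \subset Z).
  have -> : #|[set x; y; g]| = 3 by rewrite -setUA cardsU1 cards2 !inE (eq_sym x y) (eq_sym x g) (eq_sym y g) (negPf gx) (negPf yx) gy.
  move=> H3; have : 3 <= #|Z| by apply: H3; apply/subsetP=> u; rewrite !inE -orbA => /or3P[]/eqP->.
  by move: le2; case: #|Z| => [|[|[|]]].
exact: cut_dislike H sZ nZ.
Qed.

Lemma cut_single i k U g : cut i k.+2 U -> cut i k.+1 (U :\ g).
Proof.
case/cutP=> f H; apply: (@cut_drop _ _ U _ f (f g)) => [d _|]; first exact: H.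
apply/subsetP=> h; rewrite !inE => /andP[nh hU]; rewrite hU /= andbT.
by apply: contraNneq nh => hg; rewrite hg in hU *; rewrite hU eqxx.
Qed.

Lemma solvS k X U X' U' : solv k X U -> X \subset X' -> U \subset U' -> solv k X' U'.
Proof.
case=> A [a [sA cA H]] sX sU; exists A, a; split=> //; first exact: subset_trans sX.
move=> i /H; apply: likesS; apply/subsetP=> g; rewrite !inE => /andP[/(subsetP sU)-> ->//].
Qed.

Lemma solv_add k A X U (a : 'I_m -> I) l Z : A \subset X -> #|A| = k ->
  (forall i, i \in A -> likes i [set g in U :\: Z | a g == i]) ->
  l \in X -> l \notin A -> Z \subset U -> likes l Z -> solv k.+1 X U.
Proof.
move=> sA cA H lX lA sZ lZ.
exists (l |: A), (fun g => if g \in Z then l else a g); split.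
- by apply/subsetP=> i; rewrite !inE => /orP[/eqP->//|/(subsetP sA)].
- by rewrite cardsU1 lA cA.
move=> i; rewrite !inE => /orP[/eqP->|iA].
  by apply: likesS lZ; apply/subsetP=> g gZ; rewrite !inE gZ eqxx (subsetP sZ).
by apply: likesS (H i iA); apply/subsetP=> g; rewrite !inE => /andP[/andP[/negPf-> ->] ->].
Qed.

Lemma solv_give k X U l Z : l \in X -> Z \subset U -> likes l Z ->
  solv k (X :\ l) (U :\: Z) -> solv k.+1 X U.
Proof.
move=> lX sZ lZ [A [a [sA cA H]]]; apply: (solv_add (l := l) _ cA H) => //.
  exact: subset_trans sA (subsetDl _ _).
by apply/negP=> /(subsetP sA); rewrite !inE eqxx.
Qed.

(** [Z] is set aside while [k] agents are served from the rest; more than [k] agents like it, so one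
    of them is still free. Unlike in [solv_give], nobody has to leave [X] beforehand. *)
Lemma solv_later k X U (Y : {set I}) Z : Y \subset X -> k < #|Y| -> Z \subset U ->
  (forall l, l \in Y -> likes l Z) -> solv k X (U :\: Z) -> solv k.+1 X U.
Proof.
move=> sY kY sZ H [A [a [sA cA HA]]].
have [l] : exists l, l \in Y :\: A.
  apply/set0Pn; rewrite setD_eq0; apply/negP=> /subset_leq_card; lia.
rewrite inE => /andP[lA lY].
exact: (solv_add sA cA HA (subsetP sY _ lY) lA sZ (H l lY)).
Qed.

Lemma solv1 X U i : i \in X -> likes i U -> solv 1 X U.
Proof.
move=> iX H; exists [set i], (fun=> i); split; rewrite ?sub1set ?cards1 //.
move=> j; rewrite inE => /eqP->; apply: likesS H.
by apply/subsetP=> g gU; rewrite !inE gU eqxx.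
Qed.

(** Cut and choose: [j] picks from the cut of [i], so a total worth of 2 replaces a cut of its
    own. *)
Lemma solv2 X U i j : i \in X -> j \in X -> i != j -> cut i 2 U ->
  (2%:R <= worth j U)%R -> solv 2 X U.
Proof.
move=> iX jX ij /cutP[f H] wj.
have [b jb] : exists b, likes j (bun f U b).
  apply/existsP; rewrite -[X in is_true X]negbK negb_exists; apply/negP=> /forallP nl.
  have := worth_bun j f U; rewrite big_ord_recl big_ord1.
  by have := dislikeE (nl ord0); have := dislikeE (nl (lift ord0 ord0)); lra.
apply: (solv_give jX (bunS f U b) jb); apply: (@solv1 _ _ i); first by rewrite !inE ij.
apply: likesS (H (b + 1)%R); apply/subsetP=> g; rewrite !inE => /andP[gU /eqP fg].
rewrite gU fg /= andbT; apply/eqP; case: b {jb fg} => [[|[|]] b] //; move/(congr1 val) => /=; by [].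
Qed.

(** * Serving agents one at a time *)

Definition solvable r N c := forall U X, #|U| = r + c -> N <= #|X| ->
  (forall i, i \in X -> cut i r U) -> solv r X U.

Lemma solvable_le r N N' c : N <= N' -> solvable r N c -> solvable r N' c.
Proof. by move=> le H U X cU cX; apply: H cU (leq_trans le cX). Qed.

Lemma solvable2 N c : 1 < N -> solvable 2 N c.
Proof.
move=> N1 U X _ /(leq_trans N1) /card_gt1P[i [j [iX jX ij]]] H.
by apply: (solv2 iX jX ij (H i iX)); apply: cut_worth; apply: H.
Qed.

Lemma solvable_give r N c U X (W : {set I}) l Z : solvable r N c -> #|U :\: Z| = r + c ->
  Z \subset U -> l \in X -> likes l Z -> W \subset X :\ l -> N <= #|W| ->
  (forall i, i \in W -> cut i r (U :\: Z)) -> solv r.+1 X U.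
Proof.
move=> H cU sZ lX lZ sW cW HW; apply: (solv_give lX sZ lZ).
exact: solvS (H _ _ cU cW HW) sW (subxx _).
Qed.

Lemma ex_best U : 0 < #|U| -> exists2 g, g \in U & forall h, h \in U -> g <= h.
Proof.
case/card_gt0P=> g0 g0U.
case: (@arg_minnP _ g0 (fun g => g \in U) (fun g => val g) g0U) => g gU min.
by exists g.
Qed.

Lemma ex_top U k : k <= #|U| -> exists T,
  [/\ T \subset U, #|T| = k & forall x y, x \in T -> y \in U :\: T -> x < y].
Proof.
elim: k => [|k IH] lek.
  by exists set0; split; rewrite ?sub0set ?cards0 // => x y; rewrite inE.
have [T [sT cT HT]] := IH (ltnW lek).
have [x xUT min] : exists2 x, x \in U :\: T & forall y, y \in U :\: T -> x <= y.
  by apply: ex_best; rewrite card_gt0 setD_eq0; apply/negP=> /subset_leq_card; slia.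
have [xU' xT] := setDP xUT.
exists (x |: T); split.
- by apply/subsetP=> g; rewrite !inE => /orP[/eqP->//|/(subsetP sT)].
- by rewrite cardsU1 xT cT.
move=> y z; rewrite !inE negb_or => /orP[/eqP->|yT] /andP[/andP[zx zT] zU].
  by rewrite ltn_neqAle eq_sym zx min // !inE zT.
by apply: HT yT _; rewrite !inE zT.
Qed.

Lemma worth1 i g : worth i [set g] = v i g.
Proof. by rewrite /worth big_set1. Qed.

Lemma worth_dom i S T : (forall x y, x \in S -> y \in T -> x <= y) -> #|T| <= #|S| ->
  (worth i T <= worth i S)%R.
Proof.
move=> H le; have [/eqP|/ex_best[y yT min]] := posnP #|T|.
  by rewrite cards_eq0 => /eqP->; rewrite /worth big_set0; apply: sumr_ge0.
apply: (@le_trans _ _ (v i y *+ #|T|)%R).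
  by rewrite /worth -sumr_const; apply: ler_sum => z zT; apply/v_anti/min.
apply: (@le_trans _ _ (v i y *+ #|S|)%R); first by rewrite ler_wpMn2l.
by rewrite /worth -sumr_const; apply: ler_sum => z zS; apply/v_anti/H.
Qed.

(** Goods of [Z] outside [Q] also lie outside the top segment [T], so each is worse than all of [Q];
    replacing them by [Q :\: Z] loses nothing. *)
Lemma likes_worst i U T Q Z : (forall x y, x \in T -> y \in U :\: T -> x < y) ->
  Z \subset U -> Z :&: (T :\: Q) = set0 -> Q \subset T -> #|Z| <= #|Q| ->
  likes i Z -> likes i Q.
Proof.
move=> HT sZ ZT sQT le; rewrite /likes => /le_trans; apply.
rewrite [leLHS](_ : _ = worth i (Z :&: Q) + worth i (Z :\: Q))%R; last first.
  by rewrite /worth (big_setID Q).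
rewrite [leRHS](_ : _ = worth i (Z :&: Q) + worth i (Q :\: Z))%R; last first.
  by rewrite /worth (big_setID Z) /= setIC.
rewrite lerD2l; apply: worth_dom => [x y|].
  rewrite !inE => /andP[xZ xQ] /andP[yQ yZ]; apply/ltnW/HT; first exact: (subsetP sQT).
  rewrite inE (subsetP sZ _ yZ) andbT; apply: contraT; rewrite negbK => yT.
  by have := in_set0 y; rewrite -ZT !inE yZ yQ yT.
have := cardsID Q Z; have := cardsID Z Q; rewrite setIC; slia.
Qed.

Definition nosingle i U := [forall g in U, ~~ likes i [set g]].

Lemma nosingle_best i U g : g \in U -> (forall h, h \in U -> g <= h) ->
  nosingle i U = ~~ likes i [set g].
Proof.
move=> gU best; apply/forall_inP/idP => [->//|H h hU].
apply: contra H; rewrite /likes !worth1 => /le_trans; apply.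
exact/v_anti/best.
Qed.

Lemma nosingleS i U V : V \subset U -> nosingle i U -> nosingle i V.
Proof. by move=> sV /forall_inP H; apply/forall_inP=> g /(subsetP sV); apply: H. Qed.

Lemma nosingle_size i U Z : nosingle i U -> Z \subset U -> likes i Z -> 1 < #|Z|.
Proof.
move=> /forall_inP H sZ lZ; rewrite ltnNge; apply/negP => le1.
have [Z0|[g gZ]] := set_0Vmem Z.
  by move: lZ; rewrite Z0 /likes /worth big_set0 ler10.
have : Z \subset [set g].
  by apply/subsetP=> h hZ; rewrite inE; apply/eqP/(card_le1_eqP le1).
by move/likesS => /(_ _ lZ); apply/negP/H/(subsetP sZ).
Qed.

Lemma single_some r N c U X g l : solvable r.+1 N c -> #|U| = r.+2 + c -> N < #|X| ->
  (forall i, i \in X -> cut i r.+2 U) -> l \in X -> g \in U -> likes l [set g] ->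
  solv r.+2 X U.
Proof.
move=> H cU cX HX lX gU lg; apply: (solvable_give (W := X :\ l) H _ _ lX lg) => //.
- by have := cardsD1 g U; rewrite gU cU /=; slia.
- by rewrite sub1set.
- by have := cardsD1 l X; rewrite lX /=; slia.
by move=> i; rewrite inE => /andP[_ /HX]; apply: cut_single.
Qed.

Lemma single_many r N c U X Y g : solvable r.+1 N c -> #|U| = r.+2 + c -> N <= #|X| ->
  (forall i, i \in X -> cut i r.+2 U) -> g \in U -> Y \subset X -> r.+1 < #|Y| ->
  (forall l, l \in Y -> likes l [set g]) -> solv r.+2 X U.
Proof.
move=> H cU cX HX gU sY cY HY; apply: (solv_later sY cY _ HY); first by rewrite sub1set.
apply: H => //; first by move: (cardsD1 g U); rewrite gU cU /=; slia.
by move=> i /HX; apply: cut_single.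
Qed.

Lemma card_sum_mem (T : finType) (A : {set T}) : #|A| = \sum_x (x \in A : nat).
Proof. by rewrite -sum1_card big_mkcond. Qed.

Definition pairs k (f : {ffun 'I_m -> 'I_k}) U := [set b | #|bun f U b| == 2].

(** Bundles that are not pairs have at least three goods, so [3 * k - #|pairs f U|] is at most
    [k + c]. *)
Lemma pairs_lb k c (f : {ffun 'I_m -> 'I_k}) U : #|U| = k + c ->
  (forall b, 1 < #|bun f U b|) -> 2 * k <= #|pairs f U| + c.
Proof.
move=> cU H; have : \sum_b (3 - (b \in pairs f U)) <= #|U|.
  rewrite (card_bun f); apply: leq_sum => b _; rewrite inE.
  by have := H b; case: eqP; slia.
have : \sum_b (3 - (b \in pairs f U)) + #|pairs f U| = 3 * k.
  rewrite card_sum_mem -big_split /= (eq_bigr (fun=> 3)); first by rewrite sum_nat_const card_ord mulnC.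
  by move=> b _; case: (b \in _).
rewrite cU; slia.
Qed.

Lemma pigeonhole k (f : {ffun 'I_m -> 'I_k}) U T n : T \subset U -> n * k < #|T| ->
  exists b, n < #|bun f U b :&: T|.
Proof.
move=> sT ltT; apply/existsP; rewrite -[X in is_true X]negbK negb_exists.
apply/negP=> /forallP H; have := card_bunI f sT.
have : \sum_b #|T :&: bun f U b| <= \sum_(b < k) n.
  by apply: leq_sum => b _; have := H b; rewrite -leqNgt setIC.
rewrite sum_nat_const card_ord; slia.
Qed.

(** Of the [r.+3] best goods some bundle holds two, which can be traded for the two worst of them,
    [T :\: A]. Hence that pair may go to anyone who likes it. If nobody does, every liked pair has a
    good in [A], as [T :\: A] would otherwise dominate it. *)
Lemma pair_top r N c U X : solvable r.+1 N c -> #|U| = r.+3 + c -> N < #|X| ->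
  (forall i, i \in X -> cut i r.+2 U) -> solv r.+2 X U \/
  exists A : {set 'I_m}, [/\ A \subset U, #|A| = r.+1, (forall x y, x \in A -> y \in U :\: A -> x < y)
   & forall i Z, i \in X -> Z \subset U -> #|Z| = 2 -> likes i Z -> Z :&: A != set0].
Proof.
move=> H cU cX HX.
have [T [sT cT HT]] := @ex_top U r.+3 ltac:(slia).
have [A [sA cA HA]] := @ex_top T r.+1 ltac:(slia).
have sAU : A \subset U := subset_trans sA sT.
have cQ : #|T :\: A| = 2 by have := cardsD T A; rewrite (setIidPr sA); slia.
have EA : T :\: (T :\: A) = A by rewrite setDDr setDv set0U; apply/setIidPr.
have [/existsP[l /andP[lX lQ]]|/existsPn nQ] := boolP [exists l, (l \in X) && likes l (T :\: A)].
  left; apply: (solvable_give (W := X :\ l) H _ _ lX lQ) => //.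
  - have sQ : T :\: A \subset U := subset_trans (subsetDl _ _) sT.
    by have := cardsD U (T :\: A); rewrite (setIidPr sQ); slia.
  - exact: subset_trans (subsetDl _ _) sT.
  - by have := cardsD1 l X; rewrite lX /=; slia.
  move=> i; rewrite inE => /andP[_ /HX /cutP[f Hf]].
  have [b Hb] := @pigeonhole _ f U T 1 sT ltac:(slia).
  apply: (@cut_pigeon _ _ U T _ f b) => //; rewrite ?subsetDl ?cQ //.
  by move=> z x; rewrite EA => zA xQ; apply/ltnW/HA.
right; exists A; split=> //.
  move=> x y xA; rewrite inE => /andP[yA yU].
  have [yT|yT] := boolP (y \in T); first by apply: HA; rewrite // inE yA.
  by apply: HT; rewrite ?inE ?yT // (subsetP sA).
move=> i Z iX sZ cZ lZ; apply/negP=> /eqP ZA.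
have := nQ i; rewrite iX (likes_worst HT sZ _ _ _ lZ) ?EA ?subsetDl ?cQ ?cZ //.
Qed.

(** * Pairs grouped by their better good *)

Section Classes.
Variables (r c N : nat) (U : {set 'I_m}) (X : {set I}) (F : I -> {ffun 'I_m -> 'I_r.+2}).
Hypotheses (HN : solvable r.+1 N c) (cU : #|U| = r.+3 + c) (cX : N < #|X|).
Hypothesis HF : forall i b, i \in X -> likes i (bun (F i) U b).
Hypothesis unsolved : ~ solv r.+2 X U.

Definition mate x i y := [&& i \in X, x < y & [exists b, bun (F i) U b == [set x; y]]].
Definition class x := [set i | [exists y, mate x i y]].

(** Without [x] and its worst partner [w], every member of the class keeps a cut, its own freed
    partner standing in for [w]. If an outsider likes the pair, the outsider takes it and the [n.+1]
    members suffice for the rest. Otherwise the outsiders dislike it, so their cuts survive as well,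
    and the owner of the pair takes it. *)
Lemma class_bound n x : solvable r.+1 n.+1 c -> #|class x| <= n.
Proof.
move=> Hn; rewrite leqNgt; apply/negP=> le; apply: unsolved.
have /card_gt0P[i1 i1C] := leq_ltn_trans (leq0n n) le.
have := i1C; rewrite inE => /existsP[y1 m1].
case: (@arg_maxnP _ (i1, y1) (fun p => mate x p.1 p.2) (fun p => val p.2) m1) => -[i0 w] /= m0 max.
have [i0X xw /existsP[b0 /eqP E0]] := and3P m0.
have sP : [set x; w] \subset U by rewrite -E0 bunS.
have cP : #|[set x; w]| = 2 by rewrite cards2; case: eqP xw => // ->; rewrite ltnn.
have cUP : #|U :\: [set x; w]| = r.+1 + c.
  by have := cardsD U [set x; w]; rewrite (setIidPr sP); slia.
have lP : likes i0 [set x; w] by rewrite -E0 HF.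
have Hc i : i \in class x -> cut i r.+1 (U :\: [set x; w]).
  rewrite inE => /existsP[z mz]; have [iX xz /existsP[b /eqP E]] := and3P mz.
  have cutz : cut i r.+1 (U :\: [set x; z]).
    by rewrite -E; apply: (@cut_drop _ _ U _ (F i) b) => // d _; apply: HF.
  have [<-//|zw] := eqVneq z w.
  have lezw : z <= w := max (i, z) mz.
  apply: cutS (cut_exch cutz lezw _) _; first by rewrite !inE eqxx orbT.
  have zU : z \in U by apply: (subsetP (bunS (F i) U b)); rewrite E !inE eqxx orbT.
  apply/subsetP=> g; rewrite !inE => /orP[/eqP->|/and3P[gw /norP[gx gz] ->]].
    by rewrite zU andbT negb_or zw andbT; case: eqP xz => // ->; rewrite ltnn.
  by rewrite andbT negb_or gx.
have sC : class x \subset X by apply/subsetP=> i; rewrite inE => /existsP[y /and3P[]].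
have [/existsP[l /andP[lX lQ]]|/existsPn nQ] :=
    boolP [exists l, (l \in X :\: class x) && likes l [set x; w]].
  have [lC lX'] := setDP lX.
  apply: (solvable_give (W := class x) Hn cUP sP lC lQ) => //.
  by apply/subsetP=> i iC; rewrite !inE (subsetP sC) // andbT; apply: contraNneq lX' => <-.
apply: (solvable_give (W := X :\ i0) HN cUP sP i0X lP) => //.
  by have := cardsD1 i0 X; rewrite i0X /=; slia.
move=> i; rewrite inE => /andP[_ iX].
have [/Hc//|iC] := boolP (i \in class x).
apply: cut_dislike2; rewrite ?cP //; first by apply/cutP; exists (F i) => b; apply: HF.
by have := nQ i; rewrite inE iC iX.
Qed.

Lemma pair_class (A : {set 'I_m}) i b :
  (forall i Z, i \in X -> Z \subset U -> #|Z| = 2 -> likes i Z -> Z :&: A != set0) ->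
  (forall x y, x \in A -> y \in U :\: A -> x < y) -> i \in X -> b \in pairs (F i) U ->
  exists p, [/\ p \in A, i \in class p & p \in bun (F i) U b].
Proof.
move=> meetA topA iX; rewrite inE => cb; have /cards2P[p [q [pq E]]] := cb.
wlog lt_pq : p q pq E / p < q => [wl|].
  have [lt|gt|/val_inj eq] := ltngtP p q; first exact: (wl p q).
    by apply: (wl q p) => //; [rewrite eq_sym | rewrite E setUC].
  by move: pq; rewrite eq eqxx.
have sb := bunS (F i) U b; rewrite E in sb.
have pA : p \in A.
  have /set0Pn[z] : [set p; q] :&: A != set0.
    by apply: (meetA i) => //; rewrite -?E; [apply/eqP | apply: HF].
  rewrite !inE => /andP[/orP[]/eqP->// qA]; apply: contraT => pA.
  have := topA q p qA; rewrite inE pA (subsetP sb) ?inE ?eqxx // => /(_ isT); slia.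
exists p; split; rewrite ?E ?inE ?eqxx //; apply/existsP; exists q.
by rewrite /mate iX lt_pq; apply/existsP; exists b; rewrite E.
Qed.

(** Different pairs of one agent are disjoint, so their better goods are different elements of [A];
    the sum over agents is then exchanged with the sum over [A]. *)
Lemma pairs_sum (A : {set 'I_m}) : (forall i Z, i \in X -> Z \subset U -> #|Z| = 2 -> likes i Z -> Z :&: A != set0) ->
  (forall x y, x \in A -> y \in U :\: A -> x < y) ->
  \sum_(i in X) #|pairs (F i) U| <= \sum_(x in A) #|class x|.
Proof.
move=> meetA topA.
have -> : \sum_(x in A) #|class x| = \sum_(i in X) #|[set x in A | i \in class x]|.
  transitivity (\sum_(x in A) \sum_(i in X) (i \in class x : nat)).
    apply: eq_bigr => x _; rewrite card_sum_mem [RHS]big_mkcond /=.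
    apply: eq_bigr => i _; case iC: (i \in class x); case iX: (i \in X) => //.
    by move: iC; rewrite inE => /existsP[y /and3P[]]; rewrite iX.
  rewrite exchange_big /=; apply: eq_bigr => i _; rewrite card_sum_mem [LHS]big_mkcond /=.
  by apply: eq_bigr => x _; rewrite [in RHS]inE; case: (x \in A); case: (i \in class x).
apply: leq_sum => i iX.
apply: leq_trans (leq_imset_card (F i) _); apply: subset_leq_card; apply/subsetP=> b bP.
have [p [pA pC]] := pair_class meetA topA iX bP; rewrite inE => /andP[_ /eqP pb].
by apply/imsetP; exists p => //; rewrite inE pA.
Qed.

Lemma pairs_bound n : solvable r.+1 n.+1 c -> \sum_(i in X) #|pairs (F i) U| <= r.+1 * n.
Proof.
move=> Hn.
have HX i : i \in X -> cut i r.+2 U.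
  by move=> iX; apply/cutP; exists (F i) => b; apply: HF.
have [//|[A [sA cA topA meetA]]] := pair_top HN cU cX HX.
apply: leq_trans (pairs_sum meetA topA) _; rewrite -cA -sum_nat_const.
by apply: leq_sum => x _; apply: class_bound Hn.
Qed.

End Classes.

Lemma ex_cuts r U X : (forall i, i \in X -> cut i r.+1 U) ->
  exists F : I -> {ffun 'I_m -> 'I_r.+1}, forall i b, i \in X -> likes i (bun (F i) U b).
Proof.
move=> H; exists (fun i => odflt [ffun=> ord0] [pick f | cutby i U f]) => i b iX.
have /existsP[f Hf] := H i iX.
by case: pickP => [f' /forallP//|/(_ f)]; rewrite Hf.
Qed.

(** If no single good is liked, each agent has at least [2 * r.+2 - c.+1] pairs, more in all than
    the [r.+1 * n] that the classes admit. The three [solvable] hypotheses serve, in turn, a pair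
    given away, a single good given away, and the bound on a class. *)
Lemma solvable_step r N c n : solvable r.+1 N c -> solvable r.+1 N c.+1 ->
  solvable r.+1 n.+1 c -> r.+1 * n + N.+1 * c.+1 < N.+1 * (2 * r.+2) ->
  solvable r.+2 N.+1 c.+1.
Proof.
move=> H1 H2 H3 lt U X cU cX HX.
have [g gU best] := @ex_best U ltac:(slia).
have [/existsP[l /andP[lX lg]]|/existsPn nS] := boolP [exists l, (l \in X) && likes l [set g]].
  exact: single_some H2 cU cX HX lX gU lg.
have [F HF] := ex_cuts HX; apply: NNPP => ns.
have := pairs_bound H1 (eq_trans cU (addnS _ _)) cX HF ns H3.
apply/negP; rewrite -ltnNge; apply: leq_trans (_ : N.+1 * (2 * r.+2 - c.+1) <= _); first by rewrite mulnBr; slia.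
apply: leq_trans (_ : \sum_(i in X) (2 * r.+2 - c.+1) <= _); first by rewrite sum_nat_const leq_mul2r cX orbT.
apply: leq_sum => i iX; rewrite leq_subLR addnC; apply: pairs_lb cU _ => b.
apply: (@nosingle_size i U); rewrite ?bunS ?HF // (nosingle_best i gU best).
by have := nS i; rewrite iX.
Qed.

(** * Three bundles *)

Lemma solv_bun k (f : {ffun 'I_m -> 'I_k}) X U (h : 'I_k -> I) : injective h ->
  (forall b, h b \in X) -> (forall b, likes (h b) (bun f U b)) -> solv k X U.
Proof.
move=> hI hX H; exists (h @: setT), (fun g => h (f g)); split.
- by apply/subsetP=> i /imsetP[b _ ->].
- by rewrite card_imset // cardsT card_ord.
move=> i /imsetP[b _ ->]; apply: likesS (H b).
by apply/subsetP=> g; rewrite !inE => /andP[-> /eqP->] /=.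
Qed.

Lemma likes_some i k (f : {ffun 'I_m -> 'I_k.+1}) U : (k.+1%:R <= worth i U)%R ->
  exists b, likes i (bun f U b).
Proof.
move=> le; apply/existsP; rewrite -[X in is_true X]negbK negb_exists.
apply/negP=> /forallP H; move: le; apply/negP; rewrite -ltNge (worth_bun i f).
apply: (@lt_le_trans _ _ (\sum_(b < k.+1) 1)%R).
  by apply: ltr_sum => [|b _]; [apply/hasP; exists ord0; rewrite ?mem_index_enum | apply/dislikeE/H].
by rewrite sumr_const card_ord.
Qed.

Lemma worth2 i x y : x != y -> worth i [set x; y] = (v i x + v i y)%R.
Proof. by move=> xy; rewrite /worth big_setU1 ?big_set1 // inE. Qed.

Let o1 : 'I_3 := lift ord0 ord0.
Let o2 : 'I_3 := lift ord0 (lift ord0 ord0).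

Lemma ord3P (P : 'I_3 -> Prop) : P ord0 -> P o1 -> P o2 -> forall b, P b.
Proof.
move=> H0 H1 H2 [[|[|[|//]]] lt].
- by rewrite (_ : Ordinal lt = ord0) //; apply: val_inj.
- by rewrite (_ : Ordinal lt = o1) //; apply: val_inj.
- by rewrite (_ : Ordinal lt = o2) //; apply: val_inj.
Qed.

Lemma sum3 (n : 'I_3 -> nat) : \sum_b n b = n ord0 + n o1 + n o2.
Proof. by rewrite !big_ord_recl big_ord0 addn0 addnA. Qed.

Lemma other3 (b c : 'I_3) : exists d : 'I_3, [/\ d != b, d != c & forall e : 'I_3, e != b -> e != c -> b != c -> e = d].
Proof.
have [d] : exists d, d \in ~: [set b; c].
  apply/set0Pn; rewrite -card_gt0; have := cardsC [set b; c]; rewrite cards2 card_ord.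
  by case: (b != c) => /= ?; lia.
rewrite !inE negb_or => /andP[db dc]; exists d; split=> // e eb ec bc.
apply/eqP; apply: contraT => ed.
have := max_card (mem [set b; c; d; e]); rewrite card_ord.
have -> : #|[set b; c; d; e]| = 4; last by [].
rewrite setUC cardsU1 setUC cardsU1 cards2 !inE bc.
by rewrite (negPf eb) (negPf ec) (negPf ed) (negPf db) (negPf dc).
Qed.

Section Three.
Variables (U : {set 'I_m}) (X : {set I}).
Hypotheses (unsolved : ~ solv 3 X U) (cX : 2 < #|X|).
Hypothesis HX : forall i, i \in X -> cut i 3 U.

Lemma third_agent i j : exists l, [/\ l \in X, l != i & l != j].
Proof.
have [l] : exists l, l \in X :\: [set i; j].
  apply/set0Pn; rewrite setD_eq0; apply/negP=> /subset_leq_card; rewrite cards2; slia.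
by rewrite !inE negb_or => /andP[/andP[li lj] lX]; exists l.
Qed.

Definition special i (f : {ffun 'I_m -> 'I_3}) t := forall j, j \in X -> j != i ->
  likes j (bun f U t) /\ forall b, b != t -> ~~ likes j (bun f U b).

(** If two other agents liked different bundles, each would take one and [i], who likes all three,
    the third. By averaging each agent likes some bundle, and with at least two others only a common
    one remains possible. *)
Lemma ex_special i f : i \in X -> (forall b, likes i (bun f U b)) -> exists t, special i f t.
Proof.
move=> iX Hf.
have nosplit j l b c : j \in X -> l \in X -> j != i -> l != i -> j != l -> b != c ->
    likes j (bun f U b) -> likes l (bun f U c) -> False.
  move=> jX lX ji li jl bc lj ll; apply: unsolved.
  apply: (@solv_bun _ f _ _ (fun e : 'I_3 => if e == b then j else if e == c then l else i)).
  - move=> x y; case: (eqVneq x b) => [->|xb]; case: (eqVneq y b) => [->|yb] //.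
    + by case: (eqVneq y c) => _ E; move: jl ji; rewrite E eqxx.
    + by case: (eqVneq x c) => _ E; move: jl ji; rewrite -E eqxx.
    case: (eqVneq x c) => [->|xc]; case: (eqVneq y c) => [->|yc] //.
    + by move=> E; move: li; rewrite E eqxx.
    + by move=> E; move: li; rewrite -E eqxx.
    have [d [_ _ Hd]] := other3 b c.
    by rewrite (Hd x xb xc bc) (Hd y yb yc bc).
  - by move=> x; case: ifP => // _; case: ifP.
  by move=> x; case: eqP => [->//|_]; case: eqP => [->//|_]; apply: Hf.
have [j0 [j0X j0i _]] := third_agent i i.
have wX j : j \in X -> (3%:R <= worth j U)%R by move/HX/cut_worth.
have [t ht] := likes_some f (wX _ j0X).
have only j b : j \in X -> j != i -> likes j (bun f U b) -> b = t.
  move=> jX ji lj; apply/eqP; apply: contraT => bt.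
  have [jj0|jj0] := eqVneq j j0; last by case: (nosplit j j0 b t).
  have [l [lX li lj0]] := third_agent i j0.
  have [c lc] := likes_some f (wX _ lX).
  have [ct|ct] := eqVneq c t.
    by case: (nosplit j l b t); rewrite // ?jj0 1?eq_sym // -ct.
  by case: (nosplit l j0 c t).
exists t => j jX ji; split.
  by have [b lb] := likes_some f (wX _ jX); rewrite -(only j b jX ji lb).
by move=> b bt; apply: contra bt => /(only j b jX ji)->.
Qed.

(** If [b] missed [c], it would lie in the two other bundles of [j], who dislikes it and so keeps a
    cut in two without it. Then [i] takes [b] and a third agent, to whom the rest is worth more than
    2, chooses from the cut of [j]. *)
Lemma special_meets i j f (g : {ffun 'I_m -> 'I_3}) t b c : i \in X -> j \in X -> i != j ->
  (forall d, likes i (bun f U d)) -> (forall d, likes j (bun g U d)) ->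
  special i f t -> b != t -> bun f U b :&: bun g U c != set0.
Proof.
move=> iX jX ij Hf Hg sp bt; apply/negP=> /eqP E; apply: unsolved.
have ji : j != i by rewrite eq_sym.
have [_ /(_ b bt) nj] := sp j jX ji.
apply: (solv_give iX (bunS f U b) (Hf b)).
have [l [lX li lj]] := third_agent i j.
have [d [dc _ _]] := other3 c c; have [e [ec ed He]] := other3 c d.
have cutj : cut j 2 (U :\: bun f U b).
  apply: (@cut_dislike j 1 U _ g d e Hg) => //; apply/subsetP=> h hb.
  have hU := subsetP (bunS f U b) h hb.
  rewrite !inE hU /=; have [//|hd] := eqVneq (g h) d.
  apply/eqP/He => //; last by rewrite eq_sym.
  by apply/negP=> /eqP hc; have := in_set0 h; rewrite -E inE hb inE hU hc eqxx.
have jl : j != l by rewrite eq_sym.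
apply: (solv2 _ _ jl cutj); rewrite ?inE ?li ?ji //.
rewrite worthD ?bunS //.
have [_ /(_ b bt) /dislikeE nl] := sp l lX li; have := cut_worth (HX lX); lra.
Qed.

Lemma special_big i j f (g : {ffun 'I_m -> 'I_3}) t b : i \in X -> j \in X -> i != j ->
  (forall d, likes i (bun f U d)) -> (forall d, likes j (bun g U d)) ->
  special i f t -> b != t -> 2 < #|bun f U b|.
Proof.
move=> iX jX ij Hf Hg sp bt; rewrite (card_bunI g (bunS f U b)).
have H c : 0 < #|bun f U b :&: bun g U c|.
  by rewrite card_gt0; apply: special_meets Hf Hg sp bt.
rewrite sum3; have := H ord0; have := H o1; have := H o2; lia.
Qed.

Lemma two_meet (Z1 Z2 P : {set 'I_m}) : [disjoint Z1 & Z2] -> #|P| = 2 ->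
  Z1 :&: P != set0 -> Z2 :&: P != set0 -> P \subset Z1 :|: Z2.
Proof.
move=> d cP /set0Pn[x]; rewrite inE => /andP[x1 xP] /set0Pn[y].
rewrite inE => /andP[y2 yP].
have xy : x != y.
  apply: contraTneq x1 => ->; rewrite disjoint_sym in d.
  by have := disjointFr d y2 => ->.
have /eqP <- : [set x; y] == P.
  by rewrite eqEcard cP cards2 xy subUset !sub1set xP yP.
by rewrite subUset !sub1set !inE x1 y2 orbT.
Qed.

(* A good of P lies in one of the two special bundles of the third agent, which
   meets P' and so dominates P'. *)
Lemma two_pairs i j f (g : {ffun 'I_m -> 'I_3}) (b c : 'I_3) : 3 < #|U| -> i \in X -> j \in X -> i != j ->
  (forall d, likes i (bun f U d)) -> (forall d, likes j (bun g U d)) ->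
  #|bun f U b| = 2 -> #|bun g U c| = 2 -> False.
Proof.
move=> cU iX jX ij Hf Hg cb cc.
have [tf spf] := ex_special iX Hf; have [tg spg] := ex_special jX Hg.
have ji : j != i by rewrite eq_sym.
have Eb : b = tf.
  by apply/eqP; apply: contraT => /(special_big iX jX ij Hf Hg spf); rewrite cb.
have Ec : c = tg.
  by apply/eqP; apply: contraT => /(special_big jX iX ji Hg Hf spg); rewrite cc.
(* The pair of [j] meets both bundles of [i] other than the special one, so it has no room for a
   good of the pair of [i]. *)
have dPP : [disjoint bun f U b & bun g U c].
  have [d [db _ _]] := other3 b b; have [e [eb ed _]] := other3 b d.
  have := two_meet (bun_disj f U (_ : d != e)) cc.
  rewrite eq_sym ed => /(_ isT) H.
  have {}H : bun g U c \subset bun f U d :|: bun f U e.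
    by apply: H; apply: (special_meets _ iX jX ij Hf Hg spf); rewrite -Eb.
  rewrite disjoint_sym disjoints_subset; apply: subset_trans H _.
  apply/subsetP=> h; rewrite !inE negb_and => /orP[]/andP[-> /eqP->] //=.
have [c4 Ec4] : exists c4, #|U| = 4 + c4 by exists (#|U| - 4); lia.
(* For three bundles [A] consists of the two best goods; it meets both pairs, so each pair holds one
   of them. *)
have [//|[A [sA cA topA meetA]]] := @pair_top 1 2 c4 U X (@solvable2 2 c4 isT) Ec4 cX HX.
have [k [kX ki kj]] := third_agent i j.
have [h /forallP Hh] := existsP (HX kX); have [th sph] := ex_special kX Hh.
wlog [a [a' [Ea aP aP']]] : i j f g b c tf tg iX jX ij ji Hf Hg cb cc spf spg Eb Ec dPP ki kj /
   exists a a', [/\ A = [set a; a'], a \in bun f U b & a' \in bun g U c].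
  move=> wl.
  have /set0Pn[a] := meetA i _ iX (bunS f U b) cb (Hf b).
  have /set0Pn[a'] := meetA j _ jX (bunS g U c) cc (Hg c).
  rewrite !in_setI => /andP[a'P a'A] /andP[aP aA].
  have aa' : a != a'.
    by apply: contraTneq aP => ->; have := disjointFl dPP a'P => ->.
  apply: (wl i j f g b c tf tg) => //; exists a, a'; split=> //.
  apply/eqP; rewrite eq_sym eqEcard cA cards2 aa' subUset !sub1set aA a'A //.
wlog lt : i j f g b c tf tg a a' iX jX ij ji Hf Hg cb cc spf spg Eb Ec dPP ki kj Ea aP aP' / a < a'.
  move=> wl; have [lt|gt|/val_inj eq] := ltngtP a a'.
  - exact: (wl i j f g b c tf tg a a').
  - apply: (wl j i g f c b tg tf a' a) => //; first by rewrite disjoint_sym.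
    by rewrite Ea setUC.
  by move: cA; rewrite Ea eq cards2 eqxx.
have ik : k != i := ki.
have [d [dt ad]] : exists d, d != th /\ a \in bun h U d.
  have [d [dt _ _]] := other3 th th; have [e [et ed _]] := other3 th d.
  have de : d != e by rewrite eq_sym.
  have H : bun f U b \subset bun h U d :|: bun h U e.
    by apply: two_meet => //; [apply: bun_disj |
       apply: (special_meets _ kX iX ki Hh Hf sph) | apply: (special_meets _ kX iX ki Hh Hf sph)].
  by have := subsetP H a aP; rewrite in_setU => /orP[]; [exists d | exists e].
have /set0Pn[y] := special_meets c kX jX kj Hh Hg sph dt.
rewrite in_setI => /andP[yd yP].
have jk : j != k by rewrite eq_sym.
have [_ /(_ d dt)] := sph j jX jk; apply/negP; rewrite negbK.
have [w [wP wa' EP]] : exists w, [/\ w \in bun g U c, w != a' & bun g U c = [set a'; w]].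
  have /cards2P[p [q [pq E]]] : #|bun g U c| == 2 by rewrite cc.
  move: aP'; rewrite E !inE => /orP[]/eqP->.
    by exists q; rewrite !inE eqxx orbT eq_sym pq.
  by exists p; rewrite !inE eqxx pq setUC.
have aP0 : a \notin bun g U c by have := disjointFr dPP aP => ->.
have ay : a != y by apply: contraNneq aP0 => ->.
apply: (@likesS _ [set a; y]); first by rewrite subUset !sub1set ad yd.
have := Hg c; rewrite /likes EP => /le_trans; apply.
have aw : a < w.
  apply: topA; rewrite ?Ea ?inE ?eqxx // (negPf wa') orbF.
  rewrite (subsetP (bunS g U c) _ wP) andbT.
  by apply: contraNneq aP0 => <-.
have a'w : a' != w by rewrite eq_sym.
rewrite (worth2 _ ay) (worth2 _ a'w).
have := v_anti j (ltnW lt); have := v_anti j (ltnW aw).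
by move: yP; rewrite EP !inE => /orP[]/eqP->; lra.
Qed.

Lemma three_parts a b c d : 0 < a -> 0 < b -> 3 = c + (b + (a + d)) -> c <= 1.
Proof. lia. Qed.

(** A bundle that is not special meets all three bundles of the other cut, which leaves at most one
    good of a triple for the intersection. If [b] is special, it is the triple of [j] that meets the
    two other bundles of [f]. *)
Lemma inter_le1 i j f (g : {ffun 'I_m -> 'I_3}) (b c : 'I_3) : i \in X -> j \in X -> i != j ->
  (forall d, likes i (bun f U d)) -> (forall d, likes j (bun g U d)) ->
  #|bun f U b| = 3 -> #|bun g U c| = 3 -> #|bun f U b :&: bun g U c| <= 1.
Proof.
move=> iX jX ij Hf Hg cb cc; have [t sp] := ex_special iX Hf.
have meet d e : d != t -> 0 < #|bun f U d :&: bun g U e|.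
  by move=> dt; rewrite card_gt0; apply: special_meets Hf Hg sp dt.
have [Eb|bt] := eqVneq b t.
  have := card_bunI f (bunS g U c); rewrite (bigD1 b) //= cc.
  have [d [db _ _]] := other3 b b; have [e [eb ed _]] := other3 b d.
  rewrite (bigD1 d) //= (bigD1 e) /= ?eb // ![bun g U c :&: _]setIC.
  by apply: three_parts; apply: meet; rewrite -Eb.
have := card_bunI g (bunS f U b); rewrite (bigD1 c) //= cb.
have [d [dc _ _]] := other3 c c; have [e [ec ed _]] := other3 c d.
rewrite (bigD1 d) //= (bigD1 e) /= ?ec //.
by apply: three_parts; apply: meet.
Qed.

Definition triples i := [set T : {set 'I_m} | (#|T| == 3) &&
  [exists f : {ffun 'I_m -> 'I_3}, cutby i U f && [exists b, bun f U b == T]]].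

Lemma triples_inter i j T T' : i \in X -> j \in X -> i != j -> T \in triples i ->
  T' \in triples j -> #|T :&: T'| <= 1.
Proof.
rewrite !inE => iX jX ij /andP[/eqP cT /existsP[f /andP[/forallP Hf /existsP[b /eqP E]]]].
case/andP=> /eqP cT' /existsP[g /andP[/forallP Hg /existsP[c /eqP E']]].
by move: cT cT'; rewrite -E -E' => cb cc; apply: inter_le1 Hf Hg cb cc.
Qed.

Lemma triples_sub i T : T \in triples i -> T \subset U.
Proof. by rewrite inE => /andP[_ /existsP[f /andP[_ /existsP[b /eqP <-]]]]; apply: bunS. Qed.

(* Each good lies in at most four triples, as these meet only in that good. *)
Lemma triples_bound (F : I -> {set {set 'I_m}}) : #|U| = 10 ->
  (forall i, i \in X -> F i \subset triples i /\ trivIset (F i)) ->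
  \sum_(i in X) #|F i| <= 13.
Proof.
move=> cU HF.
have deg g : g \in U -> \sum_(i in X) (g \in cover (F i)) <= 4.
  move=> gU; pose B i := pblock (F i) g :\ g.
  have PB i : i \in X -> g \in cover (F i) -> pblock (F i) g \in triples i.
    by move=> iX gi; have [/subsetP s _] := HF i iX; apply/s/pblock_mem.
  have : \sum_(i in X) \sum_(h in U :\ g) ((g \in cover (F i)) && (h \in B i)) <= 9.
    rewrite exchange_big /=; apply: leq_trans (_ : \sum_(h in U :\ g) 1 <= 9); last first.
      by rewrite sum1_card; have := cardsD1 g U; rewrite gU cU; slia.
    apply: leq_sum => h hU.
    have [/existsP[i0 /and3P[i0X gi0 hi0]]|/existsPn no] :=
        boolP [exists i, [&& i \in X, g \in cover (F i) & h \in B i]]; last first.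
      by rewrite big1 // => i iX; have := no i; rewrite iX /=; case: (_ && _).
    rewrite (bigD1 i0) //= big1 ?addn0 ?leq_b1 // => i /andP[iX ii0].
    apply/eqP; rewrite eqb0; apply/negP=> /andP[gi hi].
    have := triples_inter iX i0X ii0 (PB i iX gi) (PB i0 i0X gi0).
    rewrite leqNgt; apply/negP; rewrite negbK.
    have := subset_leq_card (_ : [set g; h] \subset pblock (F i) g :&: pblock (F i0) g).
    move: hi hi0; rewrite !inE => /andP[hg hi] /andP[_ hi0].
    rewrite cards2 eq_sym hg; apply.
    by rewrite subUset !sub1set !inE !mem_pblock gi gi0 hi hi0.
  have : \sum_(i in X) 2 * (g \in cover (F i)) <=
      \sum_(i in X) \sum_(h in U :\ g) ((g \in cover (F i)) && (h \in B i)).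
    apply: leq_sum => i iX; case gi: (g \in cover (F i)); last by rewrite muln0.
    have Pi := PB i iX gi; have sP := triples_sub Pi.
    apply: leq_trans (_ : #|B i| <= _).
      move: Pi; rewrite inE => /andP[/eqP c3 _].
      by have := cardsD1 g (pblock (F i) g); rewrite mem_pblock gi c3 add1n muln1 => -[<-].
    rewrite card_sum_mem [leqRHS]big_mkcond /=; apply: leq_sum => h _; rewrite !inE.
    by case: eqP => //= _; case hB: (h \in pblock _ _) => //; rewrite (subsetP sP).
  rewrite -big_distrr /=; slia.
have cF i : i \in X -> 3 * #|F i| = #|cover (F i)|.
  move=> iX; have [sF tF] := HF i iX; have := tF; rewrite /trivIset => /eqP <-.
  rewrite (eq_bigr (fun=> 3)); first by rewrite sum_nat_const mulnC.
  by move=> T /(subsetP sF); rewrite inE => /andP[/eqP].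
(* Each triple counts three incidences, ten goods admit 40, and 40 / 3 rounds down to 13. *)
have : \sum_(i in X) #|cover (F i)| <= \sum_(g in U) 4.
  rewrite (eq_bigr (fun i => \sum_(g in U) (g \in cover (F i)))).
    by rewrite exchange_big /=; apply: leq_sum => g; apply: deg.
  move=> i iX; rewrite card_sum_mem [RHS]big_mkcond /=; apply: eq_bigr => g _.
  case gU: (g \in U) => //; apply/eqP; rewrite eqb0; apply/negP => /bigcupP[T TF gT].
  have [/subsetP s _] := HF i iX.
  by have := subsetP (triples_sub (s T TF)) g gT; rewrite gU.
rewrite -(eq_bigr _ cF) -big_distrr /= sum_nat_const cU; slia.
Qed.

End Three.

Lemma small_sum a b d c : c <= 5 -> 3 + c = a + b + d -> 1 < a -> 1 < b -> 1 < d ->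
  a != 2 -> b != 2 -> d = 2.
Proof. lia. Qed.

(** At most eight goods in three bundles of size at least two: every agent owns a pair, which
    [two_pairs] forbids. *)
Lemma solvable_small N c : c <= 5 -> 2 < N -> solvable 3 N c.
Proof.
move=> c5 N3 U X cU cX HX; apply: NNPP => ns.
have [g gU best] := @ex_best U ltac:(slia).
have cX' : 2 < #|X| by apply: leq_trans cX.
have nS i : i \in X -> nosingle i U.
  move=> iX; rewrite (nosingle_best i gU best); apply/negP=> lg; apply: ns.
  exact: (single_some (@solvable2 2 c isT) cU cX' HX iX gU lg).
have hp i : i \in X -> exists (f : {ffun 'I_m -> 'I_3}) b,
    (forall d, likes i (bun f U d)) /\ #|bun f U b| = 2.
  move=> iX; have /cutP[f Hf] := HX i iX; exists f.
  have big d : 1 < #|bun f U d| by apply: (nosingle_size (nS i iX)); rewrite ?bunS.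
  have := card_bun f U; rewrite cU sum3 => Ec.
  have := big ord0; have := big o1; have := big o2 => b2 b1 b0.
  have [e|e|e] : [\/ #|bun f U ord0| = 2, #|bun f U o1| = 2 | #|bun f U o2| = 2].
    have [|n0] := eqVneq #|bun f U ord0| 2; first by constructor 1.
    have [|n1] := eqVneq #|bun f U o1| 2; first by constructor 2.
    by constructor 3; apply: small_sum c5 Ec b0 b1 b2 n0 n1.
  - by exists ord0.
  - by exists o1.
  - by exists o2.
have [i [j [iX jX ij]]] := card_gt1P (ltnW cX').
have [f [b [Hf cb]]] := hp i iX; have [h [d [Hh cd]]] := hp j jX.
apply: (two_pairs ns cX' HX _ iX jX ij Hf Hh cb cd).
have := cb; have := cd; have := card_bun f U; have [e [eb _ _]] := other3 b b.
rewrite (bigD1 b) //= (bigD1 e) //= => ->.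
by have := nosingle_size (nS i iX) (bunS f U e) (Hf e); case: #|bun f U e| => [|[]] //; slia.
Qed.

(** * Three bundles and nine or ten goods *)

Lemma bun_inj k (f : {ffun 'I_m -> 'I_k}) U b c : 0 < #|bun f U b| ->
  bun f U b = bun f U c -> b = c.
Proof.
by case/card_gt0P=> g gb E; move: (gb); rewrite {1}E => gc; move: gb gc; rewrite !inE => /andP[_ /eqP <-] /andP[_ /eqP].
Qed.

Lemma bun_family k (f : {ffun 'I_m -> 'I_k}) U (Y : {set 'I_k}) :
  (forall b, b \in Y -> 0 < #|bun f U b|) ->
  trivIset [set bun f U b | b in Y] /\ #|[set bun f U b | b in Y]| = #|Y|.
Proof.
move=> H; split.
  apply/trivIsetP=> _ _ /imsetP[b bY ->] /imsetP[c cY ->] ne; apply: bun_disj.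
  by apply: contraNneq ne => ->.
by apply: card_in_imset => b c bY _; apply: bun_inj; apply: H.
Qed.

Definition has_pair i U := [exists f : {ffun 'I_m -> 'I_3}, cutby i U f &&
  [exists b, #|bun f U b| == 2]].

Lemma pair_agents U X : ~ solv 3 X U -> 2 < #|X| -> 3 < #|U| ->
  (forall i, i \in X -> cut i 3 U) -> #|[set i in X | has_pair i U]| <= 1.
Proof.
move=> ns cX cU HX; rewrite leqNgt; apply/negP=> /card_gt1P[i [j []]].
rewrite !inE => /andP[iX /existsP[f /andP[/forallP Hf /existsP[b /eqP cb]]]].
case/andP=> jX /existsP[g /andP[/forallP Hg /existsP[c /eqP cc]]] ij.
exact: (two_pairs ns cX HX cU iX jX ij Hf Hg cb cc).
Qed.

Lemma no_pair i U (f : {ffun 'I_m -> 'I_3}) : nosingle i U -> (forall b, likes i (bun f U b)) ->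
  ~~ has_pair i U -> forall b, 2 < #|bun f U b|.
Proof.
move=> nS Hf np b; rewrite ltn_neqAle (nosingle_size nS) ?bunS // andbT eq_sym.
apply: contra np => cb; apply/existsP; exists f; apply/andP; split; first exact/forallP.
by apply/existsP; exists b.
Qed.

Lemma unsolved_nosingle c U X i : ~ solv 3 X U -> #|U| = 3 + c -> 2 < #|X| ->
  (forall i, i \in X -> cut i 3 U) -> i \in X -> nosingle i U.
Proof.
move=> ns cU cX HX iX; have [g gU best] := @ex_best U ltac:(slia).
rewrite (nosingle_best i gU best); apply/negP=> lg; apply: ns.
exact: (single_some (@solvable2 2 c isT) cU cX HX iX gU lg).
Qed.

Lemma many_threes (n : 'I_3 -> nat) : \sum_b n b = 10 -> (forall b, 2 < n b) ->
  1 < #|[set b | n b == 3]|.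
Proof.
move=> E H; rewrite ltnNge; apply/negP=> le.
have : \sum_b (4 - (n b == 3)) <= \sum_b n b.
  by apply: leq_sum => b _; have := H b; case: eqP; slia.
have : \sum_b (4 - (n b == 3)) + #|[set b | n b == 3]| = 12.
  rewrite card_sum_mem -big_split /= (eq_bigr (fun=> 4)); first by rewrite sum_nat_const card_ord.
  by move=> b _; rewrite inE; case: (_ == _).
rewrite E; slia.
Qed.

Lemma disjoint_triples k (f : {ffun 'I_m -> 'I_k}) i U (Y : {set 'I_k}) :
  (forall b, b \in Y -> #|bun f U b| = 3 /\ bun f U b \in triples U i) ->
  exists D : {set {set 'I_m}}, [/\ D \subset triples U i, trivIset D & #|D| = #|Y|].
Proof.
move=> HY; have Y0 b : b \in Y -> 0 < #|bun f U b| by case/HY=> ->.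
have [tD cD] := bun_family Y0; exists [set bun f U b | b in Y]; split=> //.
by apply/subsetP=> _ /imsetP[b bY ->]; have [] := HY b bY.
Qed.

Lemma bun_triples (f : {ffun 'I_m -> 'I_3}) i U b : (forall b, likes i (bun f U b)) ->
  #|bun f U b| = 3 -> bun f U b \in triples U i.
Proof.
move=> Hf cb; rewrite inE cb; apply/existsP; exists f; apply/andP; split; first exact/forallP.
by apply/existsP; exists b.
Qed.

Lemma two_triples U i : nosingle i U -> #|U| = 10 -> cut i 3 U -> ~~ has_pair i U ->
  exists D : {set {set 'I_m}}, [/\ D \subset triples U i, trivIset D & 1 < #|D|].
Proof.
move=> nS cU /cutP[f Hf] np.
have [b|D [sD tD cD]] := @disjoint_triples 3 f i U [set b | #|bun f U b| == 3].
  by rewrite inE => /eqP cb; split=> //; apply: bun_triples.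
exists D; split=> //; rewrite cD; apply: many_threes; first by rewrite -card_bun.
exact: no_pair nS Hf np.
Qed.

(** At most one agent can own a pair; the others, at least seven, have two disjoint triples each,
    and 14 exceeds the bound 13. *)
Lemma solvable_ten : solvable 3 8 7.
Proof.
move=> U X cU cX HX; apply: NNPP => ns.
have cX3 : 2 < #|X| by apply: leq_trans cX.
have cU3 : 3 < #|U| by rewrite cU.
have nS i : i \in X -> nosingle i U := unsolved_nosingle ns cU cX3 HX.
have := pair_agents ns cX3 cU3 HX; set H := [set i in X | _] => pa.
have /fin_all_exists[D HD] : forall i, exists D : {set {set 'I_m}},
    i \in X -> D \subset triples U i /\ trivIset D /\ (i \notin H -> 1 < #|D|).
  move=> i; have [iX|] := boolP (i \in X); last by exists set0.
  have [iH|iH] := boolP (i \in H).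
    by exists set0 => _; rewrite sub0set; split=> //; split=> //; apply/trivIsetP=> S; rewrite inE.
  have [|D [sD tD cD]] := two_triples (nS i iX) cU (HX i iX); last by exists D.
  by move: iH; rewrite inE iX.
have HD' i : i \in X -> D i \subset triples U i /\ trivIset (D i) by case/HD=> ? [].
have := triples_bound ns cX3 HX cU HD'; apply/negP; rewrite -ltnNge.
have cY : 7 <= #|X :\: H|.
  have := cardsD X H; rewrite (setIidPr _); last by apply/subsetP=> i; rewrite inE => /andP[].
  move: pa cX; move: #|_| #|X| #|_ :\: _| => a b d; lia.
apply: leq_trans (_ : \sum_(i in X :\: H) 2 <= _); first by rewrite sum_nat_const; lia.
rewrite [leqRHS](big_setID H) /=; apply: leq_trans (leq_addl _ _).
by apply: leq_sum => i /setDP[iX iH]; have [_ [_ ->]] := HD i iX.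
Qed.

(** * Nine goods: the triples as lines *)

Section Nine.
Variables (U : {set 'I_m}) (X : {set I}) (F : I -> {ffun 'I_m -> 'I_3}).
Hypotheses (unsolved : ~ solv 3 X U) (cX : 3 < #|X|) (cU : #|U| = 9).
Hypothesis HX : forall i, i \in X -> cut i 3 U.
Hypothesis HF : forall i b, i \in X -> likes i (bun (F i) U b).

Let cX3 : 2 < #|X|. Proof. exact: ltnW. Qed.

Let line i g := bun (F i) U (F i g).

Lemma line_self i g : g \in U -> g \in line i g.
Proof. by move=> gU; rewrite inE gU eqxx. Qed.

Definition three3 i := forall b, #|bun (F i) U b| = 3.

Lemma lines_meet i j g h : i \in X -> j \in X -> i != j -> three3 i -> three3 j -> g \in U ->
  g != h -> h \in line i g -> h \in line j g -> False.
Proof.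
move=> iX jX ij ti tj gU gh hi hj.
have := inter_le1 (b := F i g) (c := F j g) unsolved cX3 HX iX jX ij (fun d => HF d iX) (fun d => HF d jX) (ti _) (tj _).
have := subset_leq_card (_ : [set g; h] \subset line i g :&: line j g).
rewrite cards2 gh subUset !sub1set !in_setI !line_self // hi hj => /(_ isT) le1 le2.
by have := leq_trans le1 le2.
Qed.

(** A line that misses the four best goods makes its owner like the goods ranked 5 to 7, and these
    can be given away, since of seven goods some bundle holds three. If there is no such line, the
    four lines through a good [x] outside [T4] share only [x] and exhaust the other eight goods, so
    each contains exactly one further good of [S5]. This would pair off five goods. *)
Lemma not_four (J : {set I}) : J \subset X -> #|J| = 4 -> (forall i, i \in J -> three3 i) -> False.
Proof.
move=> sJ cJ tJ.
have [T4 [sT4 cT4 topT4]] := @ex_top U 4 ltac:(slia).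
have [[i [b [iJ sb]]]|noline] := classic (exists i b, i \in J /\ bun (F i) U b \subset U :\: T4).
  have iX := subsetP sJ i iJ.
  have [T [sT cT topT]] := @ex_top U 7 ltac:(slia).
  have sT4T : T4 \subset T.
    apply/subsetP=> x x4; apply: contraT => xT.
    have xUT : x \in U :\: T by rewrite inE xT (subsetP sT4).
    have : T \subset T4.
      apply/subsetP=> y yT; apply: contraT => y4.
      have := topT y x yT xUT; have := topT4 x y x4.
      rewrite inE y4 (subsetP sT) // => /(_ isT) lt1 lt2.
      by have := ltn_trans lt1 lt2; rewrite ltnn.
    by move/subset_leq_card; rewrite cT cT4.
  have ED : T :\: (T :\: T4) = T4 by rewrite setDDr setDv set0U; apply/setIidPr.
  have cQ : #|T :\: T4| = 3.
    by rewrite cardsD (setIidPr sT4T) cT cT4.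
  have lQ : likes i (T :\: T4).
    apply: (likes_worst topT (bunS (F i) U b) _ _ _ (HF b iX)); rewrite ?subsetDl ?cQ ?tJ //.
    rewrite ED; apply/eqP; rewrite setI_eq0 disjoints_subset; apply: subset_trans sb _.
    by apply/subsetP=> g; rewrite !inE => /andP[].
  have sQ : T :\: T4 \subset U := subset_trans (subsetDl _ _) sT.
  apply: unsolved; apply: (solvable_give (W := X :\ i) (@solvable2 2 4 isT) _ sQ iX lQ) => //.
  - by rewrite cardsD (setIidPr sQ) cQ cU.
  - by have := cardsD1 i X; rewrite iX /=; slia.
  move=> j; rewrite inE => /andP[_ /HX /cutP[f Hf]].
  have [d Hd] := @pigeonhole _ f U T 2 sT ltac:(by rewrite cT).
  apply: (@cut_pigeon _ _ U T _ f d) => //; rewrite ?subsetDl ?cQ //.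
  by move=> z x; rewrite ED => z4 /setDP[xT x4]; apply/ltnW/topT4; rewrite // inE x4 (subsetP sT).
pose S5 := U :\: T4.
have cS5 : #|S5| = 5 by rewrite /S5 cardsD (setIidPr sT4) cU cT4.
have le1 i x : i \in J -> x \in S5 -> #|line i x :&: (S5 :\ x)| <= 1.
  move=> iJ xS; have xU : x \in U by move: xS; rewrite inE => /andP[].
  rewrite leqNgt; apply/negP=> gt1; apply: noline; exists i, (F i x); split=> //.
  have s1 : line i x :&: S5 \subset line i x by apply: subsetIl.
  have : #|line i x :&: S5| >= 3.
    have := cardsD1 x (line i x :&: S5); rewrite in_setI line_self // xS add1n => ->.
    rewrite ltnS; apply: leq_trans gt1 _; apply: subset_leq_card.
    by apply/subsetP=> y; rewrite !inE => /and3P[-> -> ->].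
  move=> ge3; have /eqP E : line i x :&: S5 == line i x.
    by rewrite eqEcard s1 /line (tJ i iJ).
  by rewrite -[bun _ _ _]E subsetIr.
have sum4 x : x \in S5 -> 4 <= \sum_(i in J) #|line i x :&: (S5 :\ x)|.
  move=> xS; have xU : x \in U by move: xS; rewrite inE => /andP[].
  have E8 : \sum_(i in J) #|line i x :\ x| = 8.
    rewrite (eq_bigr (fun=> 2)); first by rewrite sum_nat_const cJ.
    by move=> i iJ; have := cardsD1 x (line i x); rewrite line_self // /line (tJ i iJ) => -[].
  have le4 : \sum_(i in J) #|line i x :&: T4| <= 4.
    rewrite (eq_bigr (fun i => \sum_(y in T4) (y \in line i x))).
      rewrite exchange_big /= -[leqRHS]cT4 -sum1_card; apply: leq_sum => y y4.
      have xy : x != y by apply: contraTneq y4 => <-; move: xS; rewrite inE => /andP[].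
      have [/existsP[i /andP[iJ yi]]|/existsPn no] := boolP [exists i, (i \in J) && (y \in line i x)].
        rewrite (bigD1 i) //= big1 ?addn0 ?leq_b1 // => j /andP[jJ ji].
        apply/eqP; rewrite eqb0; apply/negP=> yj.
        exact: (lines_meet (subsetP sJ j jJ) (subsetP sJ i iJ) ji (tJ j jJ) (tJ i iJ) xU xy yj yi).
      by rewrite big1 // => i iJ; have := no i; rewrite iJ /=; case: (_ \in _).
    move=> i _; rewrite card_sum_mem [RHS]big_mkcond /=; apply: eq_bigr => y _.
    by rewrite in_setI; case: (y \in T4); rewrite ?andbT ?andbF.
  have : \sum_(i in J) #|line i x :\ x| <=
      \sum_(i in J) #|line i x :&: T4| + \sum_(i in J) #|line i x :&: (S5 :\ x)|.
    rewrite -big_split; apply: leq_sum => i _.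
    apply: leq_trans (leq_card_setU _ _); apply: subset_leq_card; apply/subsetP=> y.
    by rewrite !inE => /andP[-> /andP[-> ->]]; rewrite !andbT /= orbN.
  rewrite E8; move: le4; move: (\sum_(i in J) #|_|) (\sum_(i in J) #|_|) => a b; lia.
have eq1 i x : i \in J -> x \in S5 -> #|line i x :&: (S5 :\ x)| = 1.
  move=> iJ xS; apply/eqP; rewrite eqn_leq le1 //= lt0n; apply/negP=> /eqP E0.
  have := sum4 x xS; rewrite (bigD1 i) //= E0 add0n.
  have : \sum_(j in J | j != i) #|line j x :&: (S5 :\ x)| <= \sum_(j in J | j != i) 1.
    by apply: leq_sum => j /andP[jJ _]; apply: le1.
  have := cJ; rewrite -sum1_card (bigD1 i) //=.
  move: (\sum_(j in J | j != i) 1) (\sum_(j in J | _) _) => a b; lia.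
have [i iJ] : exists i, i \in J by apply/card_gt0P; rewrite cJ.
(* The lines of a single agent already match the goods of [S5] in twos. *)
have ev b : ~~ odd #|S5 :&: bun (F i) U b|.
  have [->|[x]] := set_0Vmem (S5 :&: bun (F i) U b); first by rewrite cards0.
  rewrite in_setI => /andP[xS xb].
  have Ex : F i x = b by move: xb; rewrite inE => /andP[_ /eqP].
  have := cardsD1 x (S5 :&: bun (F i) U b); rewrite in_setI xS xb.
  rewrite (_ : _ :\ x = line i x :&: (S5 :\ x)) ?eq1 // => [->//|].
  by rewrite /line Ex; apply/setP=> y; rewrite !inE; case: (y != x); case: (y \in U); case: (y \in T4); rewrite ?andbF ?andbT.
have := card_bunI (F i) (subsetDl U T4); rewrite -/S5 cS5 sum3 => E.
have := ev ord0; have := ev o1; have := ev o2; move: E.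
move: #|_| #|_| #|_| => a b c E; lia.
Qed.

Lemma likes_triple l u S T q x y : u \in S -> u \in T -> S :\ u = [set q; x] -> q != x ->
  #|T| = 3 -> y \in T -> y != u -> x <= y -> (forall z, z \in T -> z != u -> q <= z) ->
  likes l T -> likes l S.
Proof.
move=> uS uT ES qx cT yT yu xy qz; rewrite /likes => /le_trans; apply.
rewrite /worth (big_setD1 u uT) (big_setD1 u uS) /= lerD2l.
have /cards2P[a [b [ab ET]]] : #|T :\ u| == 2.
  by have := cardsD1 u T; rewrite uT cT add1n => -[<-].
have : y \in T :\ u by rewrite inE yT andbT inE yu.
have Hq z : z \in T :\ u -> q <= z by rewrite !inE => /andP[zu zT]; apply: qz.
rewrite ES ET !big_setU1 ?inE ?big_set1 //=.
have qa : q <= a by apply: Hq; rewrite ET !inE eqxx.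
have qb : q <= b by apply: Hq; rewrite ET !inE eqxx orbT.
move=> /orP[] /eqP E; subst y.
  by rewrite addrC; apply: lerD; apply: v_anti.
by apply: lerD; apply: v_anti.
Qed.

(** What a pair [{u, p}] in the cut of a further agent forces on [i]: both bundles other than the
    special one meet the pair, hence they are [line i u] and [line i p], with the properties of
    bundles that are not special. *)
Definition spread u p i := [/\ i \in X, three3 i, F i u != F i p &
  forall j, j \in X -> j != i -> [/\ ~~ likes j (line i u), ~~ likes j (line i p) &
    forall b, line i u :&: bun (F j) U b != set0 /\ line i p :&: bun (F j) U b != set0]].

Lemma spread_sym u p i : spread u p i -> spread p u i.
Proof.
case=> iX ti ne H; split=> //; first by rewrite eq_sym.
by move=> j jX ji; have [h1 h2 h3] := H j jX ji; split=> // b; have [] := h3 b.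
Qed.

Lemma line_out i u p : u \in U -> F i u != F i p -> u \notin line i p.
Proof. by move=> uU; rewrite inE uU. Qed.

Lemma line_two i u q x : u \in U -> three3 i -> q \in line i u -> x \in line i u ->
  q != u -> x != u -> q != x -> line i u :\ u = [set q; x].
Proof.
move=> uU ti qi xi qu xu qx; apply/esym/eqP.
rewrite eqEcard subUset !sub1set !in_setD1 qu xu qi xi cards2 qx /=.
by have := cardsD1 u (line i u); rewrite line_self // /line ti add1n => -[<-].
Qed.

Lemma spread_meet u p i k x : u \in U -> p \in U -> spread u p i -> spread u p k -> i != k ->
  x \in line i u -> x \in line k u -> x = u.
Proof.
move=> uU pU [iX ti _ _] [kX tk _ _] ik xi xk; apply/eqP; apply: contraT => xu.
by case: (@lines_meet i k u x iX kX ik ti tk uU); rewrite 1?eq_sym.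
Qed.

(** [line i u] is [{u, q, x}] with [x] on [line l p], and [line k p] is [{p, q, y}] with [y] on
    [line l u]. If [x] is at least as good as [y], the former dominates [line l u], because [q]
    beats the third good there; otherwise the latter dominates [line l p]. Either way [l] likes a
    bundle that it should dislike. *)
Lemma spread_three u p i k l (q : 'I_m) : u \in U -> p \in U -> spread u p i -> spread u p k ->
  spread u p l -> i != k -> i != l -> k != l -> q \in line i u -> q != u -> q \in line k p ->
  q != p -> (forall z, z \in line l u -> z != u -> q <= z) ->
  (forall z, z \in line l p -> z != p -> q <= z) -> False.
Proof.
move=> uU pU Si Sk Sl ik il kl qi qu qk qp mu mp.
have [[iX ti nei Hi] [kX tk nek Hk] [lX tl nel Hl]] := And3 Si Sk Sl.
have [nli _ mi] := Hi l lX ltac:(by rewrite eq_sym).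
have [_ nlk mk] := Hk l lX ltac:(by rewrite eq_sym).
have [/set0Pn[x /setIP[xi xl]] _] := mi (F l p).
have [_ /set0Pn[y /setIP[yk yl]]] := mk (F l u).
have xu : x != u by apply: contraTneq xl => ->; apply: line_out.
have yp : y != p by apply: contraTneq yl => ->; apply: line_out; rewrite // eq_sym.
have xp : x != p by apply: contraTneq xi => ->; apply: line_out; rewrite // eq_sym.
have yu : y != u by apply: contraTneq yk => ->; apply: line_out.
have qx : q != x.
  apply: contraNneq qp => E; rewrite E in qk *.
  by rewrite (spread_meet (u := p) (p := u) pU uU (spread_sym Sk) (spread_sym Sl) kl qk xl).
have qy : q != y.
  apply: contraNneq qu => E; rewrite E in qi *.
  by rewrite (spread_meet (u := u) (p := p) uU pU Si Sl il qi yl).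
have [xy|/ltnW yx] := leqP x y.
  case/negP: nli; apply: (likes_triple _ _ (line_two uU ti qi xi qu xu qx) qx (tl _) yl yu xy mu);
    by [apply: line_self | apply: HF].
case/negP: nlk; apply: (likes_triple _ _ (line_two pU tk qk yk qp yp qy) qy (tl _) xl xp yx mp);
  by [apply: line_self | apply: HF].
Qed.

(** [line i u] meets [line k p] and [line l p] in two different goods other than [u], and has no
    more; so [q] is one of them, the situation of [spread_three]. *)
Lemma spread_all u p i (q : 'I_m) (J : {set I}) : u \in U -> p \in U -> #|J| = 3 ->
  (forall i, i \in J -> spread u p i) ->
  (forall i, i \in J -> forall z, z \in line i u -> z != u -> q <= z) ->
  (forall i, i \in J -> forall z, z \in line i p -> z != p -> q <= z) ->
  i \in J -> q \in line i u -> q != u -> False.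
Proof.
move=> uU pU cJ HJ mu mp iJ qi qu.
have /cards2P[k [l [kl E]]] : #|J :\ i| == 2 by have := cardsD1 i J; rewrite iJ cJ add1n => -[<-].
have : k \in J :\ i by rewrite E !inE eqxx.
have : l \in J :\ i by rewrite E !inE eqxx orbT.
rewrite !inE => /andP[li lJ] /andP[ki kJ].
have [Si Sk Sl] := And3 (HJ _ iJ) (HJ _ kJ) (HJ _ lJ).
have [iX ti nei Hi] := Si; have [kX tk nek Hk] := Sk; have [lX tl nel Hl] := Sl.
have [_ _ mk] := Hi k kX ki; have [_ _ ml] := Hi l lX li.
have [/set0Pn[x /setIP[xi xk]] _] := mk (F k p).
have [/set0Pn[y /setIP[yi yl]] _] := ml (F l p).
have xu : x != u by apply: contraTneq xk => ->; apply: line_out.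
have yu : y != u by apply: contraTneq yl => ->; apply: line_out.
have xp : x != p by apply: contraTneq xi => ->; apply: line_out; rewrite // eq_sym.
have yp : y != p by apply: contraTneq yi => ->; apply: line_out; rewrite // eq_sym.
have xy : x != y.
  apply: contraNneq xp => Exy; rewrite -Exy in yl.
  by rewrite (spread_meet (u := p) (p := u) pU uU (spread_sym Sk) (spread_sym Sl) kl xk yl).
have : q \in line i u :\ u by rewrite in_setD1 qu qi.
rewrite (line_two uU ti xi yi xu yu xy) !inE => /orP[] /eqP Eq; subst q.
  apply: (@spread_three u p i k l x) => //; rewrite 1?eq_sym //; [exact: mu | exact: mp].
apply: (@spread_three u p i l k y) => //; rewrite 1?eq_sym //; [exact: mu | exact: mp].
Qed.

Lemma not_three (J : {set I}) j b u p : J \subset X -> #|J| = 3 ->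
  (forall i, i \in J -> three3 i) -> j \in X -> j \notin J -> u != p ->
  bun (F j) U b = [set u; p] -> False.
Proof.
move=> sJ cJ tJ jX nj up Eb.
have uU : u \in U by apply: (subsetP (bunS (F j) U b)); rewrite Eb !inE eqxx.
have pU : p \in U by apply: (subsetP (bunS (F j) U b)); rewrite Eb !inE eqxx orbT.
have HJ i : i \in J -> spread u p i.
  move=> iJ; have iX := subsetP sJ i iJ.
  have ij : i != j by apply: contraNneq nj => <-.
  have [t sp] := ex_special unsolved cX3 HX iX (fun d => HF d iX).
  have mt k d e : k \in X -> k != i -> d != t -> bun (F i) U d :&: bun (F k) U e != set0.
    move=> kX ki dt; have ik : i != k by rewrite eq_sym.
    exact: (special_meets unsolved cX3 HX (b := d) e iX kX ik (fun d => HF d iX) (fun d => HF d kX) sp dt).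
  have pt d : d != t -> F i u = d \/ F i p = d.
    move=> dt; have /set0Pn[x] := mt j d b jX ltac:(by rewrite eq_sym) dt.
    by rewrite Eb !inE => /andP[/andP[_ /eqP<-]] /orP[] /eqP->; [left|right].
  have [d [dt _ _]] := other3 t t; have [e [et ed _]] := other3 t d.
  have [ne [ut ptt]] : F i u != F i p /\ (F i u != t /\ F i p != t).
    case: (pt d dt) (pt e et) => Ed [] Ee; move: dt et ed; rewrite -?Ed -?Ee ?eqxx // => h1 h2 h3.
    by rewrite eq_sym.
  split=> // [|k kX ki]; first exact: tJ.
  have [_ nk] := sp k kX ki.
  by split=> [||c]; [apply: nk | apply: nk | split; apply: mt].
have [i iJ] : exists i, i \in J by apply/card_gt0P; rewrite cJ.
(* The good [q] will be the best one on all lines through [u] or [p], these two excepted. *)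
pose W := [set g | [exists i in J, ((g \in line i u) && (g != u)) || ((g \in line i p) && (g != p))]].
have W0 : 0 < #|W|.
  have [iX ti nei Hi] := HJ i iJ; have [_ _ _] := Hi j jX ltac:(by apply: contraNneq nj => ->).
  have : 0 < #|line i u :\ u|.
    by have := cardsD1 u (line i u); rewrite line_self // /line ti add1n => -[<-].
  case/card_gt0P=> g; rewrite in_setD1 => /andP[gu gi].
  by apply/card_gt0P; exists g; rewrite inE; apply/existsP; exists i; rewrite iJ gi gu.
have [q qW min] := ex_best W0.
have mu k : k \in J -> forall z, z \in line k u -> z != u -> q <= z.
  by move=> kJ z zk zu; apply: min; rewrite inE; apply/existsP; exists k; rewrite kJ zk zu.
have mp k : k \in J -> forall z, z \in line k p -> z != p -> q <= z.
  by move=> kJ z zk zu; apply: min; rewrite inE; apply/existsP; exists k; rewrite kJ zk zu orbT.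
move: qW; rewrite inE => /existsP[k /andP[kJ /orP[] /andP[qk qn]]].
  exact: (@spread_all u p k q J).
by apply: (@spread_all p u k q J) => // h hJ; apply/spread_sym/HJ.
Qed.

End Nine.

Lemma ex_subset (T : finType) (A : {set T}) n : n <= #|A| -> exists2 B : {set T}, B \subset A & #|B| = n.
Proof.
case/card_geqP=> s [us ss sA]; exists [set x in s]; first by apply/subsetP=> x; rewrite inE; apply: sA.
by rewrite cardsE; have /card_uniqP -> := us.
Qed.

Lemma all_threes (n : 'I_3 -> nat) : \sum_b n b = 9 -> (forall b, 2 < n b) -> forall b, n b = 3.
Proof.
move=> E H; have := H ord0; have := H o1; have := H o2; move: E; rewrite sum3.
move=> E0 h2 h1 h0; apply: ord3P; lia.
Qed.

Lemma solvable_nine : solvable 3 4 6.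
Proof.
move=> U X cU cX HX; apply: NNPP => ns.
have cX3 : 2 < #|X| by apply: leq_trans cX.
have cU3 : 3 < #|U| by rewrite cU.
have nS i : i \in X -> nosingle i U := unsolved_nosingle ns cU cX3 HX.
have := pair_agents ns cX3 cU3 HX; set H := [set i in X | _] => pa.
have [F HF] := ex_cuts HX.
have t3 i (f : {ffun 'I_m -> 'I_3}) : i \in X -> i \notin H -> (forall b, likes i (bun f U b)) ->
    forall b, #|bun f U b| = 3.
  move=> iX iH Hf; apply: all_threes; first by rewrite -card_bun.
  by apply: (no_pair (nS i iX)) => //; apply: contra iH => h; rewrite inE iX.
have [H0|[j jH]] := set_0Vmem H.
  have [J sJ cJ] := ex_subset cX.
  apply: (not_four ns cX cU HX HF sJ cJ) => i iJ b.
  have iX := subsetP sJ i iJ.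
  by apply: (t3 i (F i) iX _ (fun d => HF _ d iX)); rewrite H0 inE.
move: (jH); rewrite inE => /andP[jX /existsP[f /andP[/forallP Hf /existsP[b /eqP cb]]]].
have [J sJ cJ] : exists2 J : {set I}, J \subset X :\ j & #|J| = 3.
  by apply: ex_subset; have := cardsD1 j X; rewrite jX; slia.
have HE : H = [set j] by apply/eqP; rewrite eq_sym eqEcard sub1set jH cards1.
(* The cut that [F] chose for [j] need not contain a pair, so it is replaced by one that does. *)
pose G i := if i == j then f else F i.
have HG i c : i \in X -> likes i (bun (G i) U c).
  by rewrite /G; case: eqP => [->|_] iX; [apply: Hf | apply: HF].
have /cards2P[u [p [up E]]] : #|bun f U b| == 2 by rewrite cb.
have sJX : J \subset X := subset_trans sJ (subsetDl _ _).
have tJ i : i \in J -> forall c, #|bun (G i) U c| = 3.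
  move=> /(subsetP sJ); rewrite !inE => /andP[ij iX].
  by apply: (t3 i (G i) iX _ (fun d => HG _ d iX)); rewrite HE inE.
have nj : j \notin J by apply/negP=> /(subsetP sJ); rewrite !inE eqxx.
have EG : bun (G j) U b = [set u; p] by rewrite /G eqxx.
exact: (not_three ns cX HX HG sJX cJ tJ jX nj up EG).
Qed.

(** * Seven goods more than bundles: small cases *)

Lemma solvable_4_4_4 : solvable 4 4 4.
Proof. by apply: (@solvable_step 2 3 3 2); try exact: solvable_small. Qed.

Lemma solvable_4_4_5 : solvable 4 4 5.
Proof. by apply: (@solvable_step 2 3 4 2); try exact: solvable_small. Qed.

(** At surplus 6 each further bundle costs a further agent, because a single good given away takes
    its owner along. From four agents for three bundles this reaches seven for six, just what eight
    agents at surplus 7 afford after a pair is given away. *)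
Lemma solvable_4_5_6 : solvable 4 5 6.
Proof.
by apply: (@solvable_step 2 4 5 2) => //; [apply: solvable_small | apply: solvable_nine | apply: solvable_small].
Qed.

Lemma solvable_5_6_5 : solvable 5 6 5.
Proof.
apply: (@solvable_step 3 5 4 3) => //; last exact: solvable_4_4_4.
  exact: solvable_le solvable_4_4_4.
exact: solvable_le solvable_4_4_5.
Qed.

Lemma solvable_5_6_6 : solvable 5 6 6.
Proof.
apply: (@solvable_step 3 5 5 3) => //; last exact: solvable_4_4_5.
  exact: solvable_le solvable_4_4_5.
exact: solvable_4_5_6.
Qed.

Lemma solvable_6_7_6 : solvable 6 7 6.
Proof.
by apply: (@solvable_step 4 6 5 5) => //; [exact: solvable_5_6_5 | exact: solvable_5_6_6 | exact: solvable_5_6_5].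
Qed.

(** * Cuts made mostly of pairs *)

Definition nonpairs k (f : {ffun 'I_m -> 'I_k}) U := [set b | #|bun f U b| != 2].

Definition mostly t k i U :=
  [exists f : {ffun 'I_m -> 'I_k}, cutby i U f && (#|nonpairs f U| <= t)].

Lemma pairs_nonpairs k (f : {ffun 'I_m -> 'I_k}) U : #|pairs f U| + #|nonpairs f U| = k.
Proof.
have -> : nonpairs f U = ~: pairs f U by apply/setP=> b; rewrite !inE.
by rewrite cardsC card_ord.
Qed.

Lemma nosingle_mostly k t i U : nosingle i U -> cut i k U -> #|U| = 2 * k + t -> mostly t k i U.
Proof.
move=> nS /cutP[f Hf] cU; apply/existsP; exists f; apply/andP; split; first exact/forallP.
have := @pairs_lb k (k + t) f U ltac:(slia) _; have := pairs_nonpairs f U.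
move: #|pairs f U| #|nonpairs f U| => a b E /(_ (fun b => nosingle_size nS (bunS f U b) (Hf b))); lia.
Qed.

Definition merge k (f : {ffun 'I_m -> 'I_k.+2}) b d : {ffun 'I_m -> 'I_k.+1} :=
  [ffun h => odflt d (unlift b (f h))].

Lemma merge_bun k (f : {ffun 'I_m -> 'I_k.+2}) U g (d c : 'I_k.+1) : g \in U -> c != d ->
  bun (merge f (f g) d) (U :\ g) c = bun f U (lift (f g) c).
Proof.
move=> gU cd; apply/setP=> h; rewrite !inE ffunE.
have [->|hg] := eqVneq h g; first by rewrite /= gU (negPf (neq_lift (f g) c)).
case: unliftP => [e ->|->] /=; first by rewrite (inj_eq lift_inj).
by rewrite eq_sym (negPf cd) (negPf (neq_lift (f g) c)).
Qed.

Lemma merge_likes k (f : {ffun 'I_m -> 'I_k.+2}) i U g (d c : 'I_k.+1) :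
  (forall b, likes i (bun f U b)) -> likes i (bun (merge f (f g) d) (U :\ g) c).
Proof.
move=> Hf; apply: likesS (Hf (lift (f g) c)).
apply/subsetP=> h; rewrite !inE ffunE => /andP[hU /eqP E]; rewrite hU E liftK eqxx !andbT.
by apply/negP=> /eqP hg; have := neq_lift (f g) c; rewrite -E hg eqxx.
Qed.

(** The bundle of [g] is dissolved into a bundle that is not a pair anyway. If all the others are
    pairs, one of them is spoilt, which [0 < t] permits. *)
Lemma mostly_peel t k i U g : g \in U -> 0 < t -> mostly t k.+2 i U -> mostly t k.+1 i (U :\ g).
Proof.
move=> gU t0 /existsP[f /andP[/forallP Hf le]].
have [d Hd] : exists d : 'I_k.+1, #|nonpairs (merge f (f g) d) (U :\ g)| <= t.
  have [/existsP[d Hd]|/existsPn no] := boolP [exists d, lift (f g) d \in nonpairs f U].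
    exists d; apply: leq_trans le; rewrite -(card_imset _ (@lift_inj _ (f g))).
    apply: subset_leq_card; apply/subsetP=> _ /imsetP[c + ->]; have [->//|cd] := eqVneq c d.
    by rewrite !inE merge_bun.
  exists ord0; apply: leq_trans t0; rewrite -(cards1 (ord0 : 'I_k.+1)); apply: subset_leq_card.
  apply/subsetP=> c; rewrite !inE; apply: contraR => cd.
  by have := no c; rewrite inE merge_bun // negbK.
apply/existsP; exists (merge f (f g) d); rewrite Hd andbT.
by apply/forallP=> c; apply: merge_likes.
Qed.

Lemma no_best c k U X : #|U| = k.+1 + c -> (exists g l, [/\ g \in U, l \in X & likes l [set g]]) \/
  forall i, i \in X -> nosingle i U.
Proof.
move=> cU; have [g gU best] := @ex_best U ltac:(slia).
have [/existsP[l /andP[lX lg]]|/existsPn nS] := boolP [exists l, (l \in X) && likes l [set g]].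
  by left; exists g, l.
by right=> i iX; rewrite (nosingle_best i gU best); have := nS i; rewrite iX.
Qed.

Lemma likes_nosingle l i g U : g \in U -> likes l [set g] -> nosingle i U -> i != l.
Proof. by move=> gU lg /forall_inP /(_ g gU); apply: contraNneq => ->. Qed.

(** If a single good is liked, three bundles remain after its removal, at most [t <= 2] of them not
    pairs, so two agents of [D] own pairs, which is impossible. Otherwise the classes admit 3 * 3 =
    9 pairs, while each agent has at least one pair and each agent of [D] at least [4 - t]. *)
Lemma solv_mostly t U X (D : {set I}) : 0 < t <= 2 -> #|U| = 11 -> 4 < #|X| ->
  (forall i, i \in X -> cut i 4 U) -> D \subset X -> 1 < #|D| -> 9 < #|X| + #|D| * (3 - t) ->
  (forall i, i \in D -> nosingle i U /\ mostly t 4 i U) -> solv 4 X U.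
Proof.
move=> /andP[t0 t2] cU cX HX sD cD lt HD; apply: NNPP => ns.
have [[g [l [gU lX lg]]]|nS] := @no_best 7 3 U X cU.
  have ns3 : ~ solv 3 (X :\ l) (U :\ g).
    by move=> s; apply: ns; apply: (solv_give lX _ lg s); rewrite sub1set.
  have cX3 : 2 < #|X :\ l| by have := cardsD1 l X; rewrite lX; slia.
  have cU3 : 3 < #|U :\ g| by have := cardsD1 g U; rewrite gU; slia.
  have HX3 i : i \in X :\ l -> cut i 3 (U :\ g).
    by rewrite inE => /andP[_ /HX]; apply: cut_single.
  have HD3 i : i \in D -> i \in X :\ l /\ has_pair i (U :\ g).
    move=> iD; have [nSi mi] := HD i iD; split.
      by rewrite !inE (likes_nosingle gU lg nSi) (subsetP sD).
    have /existsP[f /andP[Hf lef]] := mostly_peel gU t0 mi; apply/existsP; exists f; rewrite Hf /=.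
    have : 0 < #|pairs f (U :\ g)|.
      have := pairs_nonpairs f (U :\ g); move: lef t2; move: #|pairs _ _| #|nonpairs _ _| => a b; lia.
    by case/card_gt0P=> b; rewrite inE => cb; apply/existsP; exists b.
  have := pair_agents ns3 cX3 cU3 HX3; apply/negP; rewrite -ltnNge.
  apply: leq_trans cD _; apply: subset_leq_card; apply/subsetP=> i /HD3[iX hp].
  by rewrite inE iX.
pose G i := odflt [ffun=> ord0] [pick f : {ffun 'I_m -> 'I_4} | cutby i U f && ((i \in D) ==> (#|nonpairs f U| <= t))].
have HG i : i \in X -> cutby i U (G i) /\ (i \in D -> #|nonpairs (G i) U| <= t).
  move=> iX; rewrite /G; case: pickP => [f /andP[Hf /implyP Df]|no]; first by [].
  have [iD|iD] := boolP (i \in D).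
    by have /existsP[f] := (HD i iD).2; have := no f; rewrite iD /= => ->.
  by have /existsP[f Hf] := HX i iX; have := no f; rewrite Hf (negPf iD).
have HGl i b : i \in X -> likes i (bun (G i) U b) by case/HG=> /forallP.
have := pairs_bound solvable_nine cU cX HGl ns solvable_nine.
apply/negP; rewrite -ltnNge; apply: leq_trans lt _.
rewrite -sum1_card -sum_nat_const [X in _ + X]big_mkcond /= [X in X <= _]addnC.
rewrite (_ : \sum_i (if i \in D then 3 - t else 0) = \sum_(i in X) (if i \in D then 3 - t else 0)); last first.
  rewrite [RHS]big_mkcond /=; apply: eq_bigr => i _; case iD: (i \in D); last by case: ifP.
  by rewrite (subsetP sD).
rewrite -big_split; apply: leq_sum => i iX /=.
have := pairs_nonpairs (G i) U; have := @pairs_lb 4 7 (G i) U cU (fun b => nosingle_size (nS i iX) (bunS _ _ b) (HGl i b iX)).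
have := (HG i iX).2; case: (i \in D) => [/(_ isT)|_]; move: #|pairs _ _| #|nonpairs _ _| => a b; lia.
Qed.

(** * Chains of triples of ranks *)

Definition triple : Type := nat * nat * nat.

Definition dom (s t : triple) := [&& s.1.1 <= t.1.1, s.1.2 <= t.1.2 & s.2 <= t.2].

Definition ranks_ok (s : triple) := [&& s.1.1 < s.1.2, s.1.2 < s.2 & s.2 < 11].

Definition worsen (s : triple) k : triple :=
  match k with
  | 0 => (s.1.1.+1, s.1.2, s.2)
  | 1 => (s.1.1, s.1.2.+1, s.2)
  | _ => (s.1.1, s.1.2, s.2.+1)
  end.

Definition chain a b c steps : seq triple := (a, b, c) :: scanl worsen (a, b, c) steps.

(* A partition of the 165 triples of ranks into 13 chains; 13 is the number of partitions of 12
   into at most three parts of size at most 8, the middle level of this poset. *)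
Definition chains : seq (seq triple) :=
  [:: chain 0 1 2 (nseq 8 2 ++ nseq 8 1 ++ nseq 8 0);
      chain 0 2 3 (nseq 6 2 ++ nseq 6 1 ++ nseq 7 0);
      chain 0 3 4 (nseq 4 2 ++ nseq 4 1 ++ nseq 6 0);
      chain 0 4 5 (nseq 2 2 ++ nseq 2 1 ++ nseq 5 0);
      chain 0 5 6 [:: 0; 2; 0; 2; 0; 2; 0; 2];
      chain 1 2 3 (nseq 7 2 ++ nseq 6 1 ++ nseq 6 0);
      chain 1 3 4 (nseq 5 2 ++ nseq 4 1 ++ nseq 5 0);
      chain 1 4 5 (nseq 3 2 ++ nseq 2 1 ++ nseq 4 0);
      chain 2 3 4 (nseq 6 2 ++ nseq 4 1 ++ nseq 4 0);
      chain 2 4 5 (nseq 4 2 ++ nseq 2 1 ++ nseq 3 0);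
      chain 2 5 6 [:: 0; 2; 0; 2];
      chain 3 4 5 (nseq 5 2 ++ nseq 2 1 ++ nseq 2 0);
      chain 4 5 6 [::]].

Lemma dom_refl : reflexive dom.
Proof. by move=> s; rewrite /dom !leqnn. Qed.

Lemma dom_trans : transitive dom.
Proof.
move=> t s u /and3P[h1 h2 h3] /and3P[k1 k2 k3].
by rewrite /dom (leq_trans h1) // (leq_trans h2) // (leq_trans h3).
Qed.

Lemma chain_dom c s t : c \in chains -> s \in c -> t \in c -> dom s t || dom t s.
Proof.
move=> cC; have sc : sorted dom c.
  have H : all (sorted dom) chains by vm_compute.
  by move/allP: H; apply.
move: sc; rewrite (sorted_pairwise dom_trans).
elim: c {cC} => // u c IH /= /andP[/allP uc pc].
rewrite !inE => /orP[/eqP->|sc] /orP[/eqP->|tc]; rewrite ?dom_refl ?uc ?orbT //.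
exact: IH.
Qed.

Lemma chain_cover s : ranks_ok s -> exists2 p : 'I_13, s \in nth [::] chains p & nth [::] chains p \in chains.
Proof.
case: s => [[a b] c] /and3P[/= ab bc c11].
have : has (fun d => (a, b, c) \in d) chains.
  have H : all (fun a => all (fun b => all (fun c => (a < b < c) ==>
      has (fun d => (a, b, c) \in d) chains) (iota 0 11)) (iota 0 11)) (iota 0 11).
    by vm_compute.
  have b11 := ltn_trans bc c11; have a11 := ltn_trans ab b11.
  move/allP/(_ a): H; rewrite mem_iota a11 => /(_ isT) /allP/(_ b); rewrite mem_iota b11.
  by move=> /(_ isT) /allP/(_ c); rewrite mem_iota c11 ab bc => /(_ isT).
move=> hC; have lt := hC; rewrite has_find in lt; exists (Ordinal lt) => /=.
  exact: (nth_find [::] hC).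
exact: mem_nth.
Qed.

(** [x] lowers the first rank of [t], [y] another rank that has a gap below it. If the ranks of [t]
    are consecutive there is no gap, but then disjointness forces [s.1.1 <= t.1.1 - 2], which makes
    room for the last two witnesses. *)
Lemma interval s t : ranks_ok s -> ranks_ok t -> dom s t ->
  (s.1.1 != t.1.1) && (s.1.1 != t.1.2) && (s.1.1 != t.2) &&
  (s.1.2 != t.1.1) && (s.1.2 != t.1.2) && (s.1.2 != t.2) &&
  (s.2 != t.1.1) && (s.2 != t.1.2) && (s.2 != t.2) ->
  exists x y : triple, [/\ ranks_ok x, ranks_ok y, dom s x && dom x t, dom s y && dom y t
    & ~~ dom x y && ~~ dom y x].
Proof.
case: s t => [[a1 a2] a3] [[b1 b2] b3]; rewrite /ranks_ok /dom /= => Ha Hb Hd Hn.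
have [h1|h1] := leqP b1.+2 b2.
  by exists (b1.-1, b2, b3), (b1, b2.-1, b3); split=> /=; lia.
have [h2|h2] := leqP b2.+2 b3.
  by exists (b1.-1, b2, b3), (b1, b2, b3.-1); split=> /=; lia.
by exists (b1.-2, b2, b3), (b1.-1, b2.-1, b3); split=> /=; lia.
Qed.

Section Ranks.
Variables (e : nat -> 'I_m) (Z : {set I}).
Hypothesis e_mono : forall a b, a <= b -> b < 11 -> e a <= e b.

Definition rworth i (s : triple) : R := (v i (e s.1.1) + v i (e s.1.2) + v i (e s.2))%R.

Definition owns i s := [/\ ranks_ok s, (1 <= rworth i s)%R &
  forall l, l \in Z -> l != i -> (rworth l s < 1)%R].

Lemma rworth_dom i s t : ranks_ok t -> dom s t -> (rworth i t <= rworth i s)%R.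
Proof.
case/and3P=> t1 t2 t3 /and3P[d1 d2 d3].
have t2' := ltn_trans t2 t3; have t1' := ltn_trans t1 t2'.
by rewrite /rworth !lerD // v_anti // e_mono.
Qed.

(** The owner of the worse triple would like the better one too. Hence a chain has at most one
    owner. *)
Lemma owns_apart i j s t : i \in Z -> j \in Z -> i != j -> owns i s -> owns j t -> ~~ dom s t.
Proof.
move=> iZ jZ ij [os ls ns] [ot lt nt]; apply/negP=> /(rworth_dom j ot) le.
by have := ns j jZ; rewrite eq_sym ij => /(_ isT); have := le_trans lt le; lra.
Qed.

Lemma owns_between i (s x t : triple) : i \in Z -> owns i s -> owns i t -> ranks_ok x -> dom s x -> dom x t ->
  owns i x.
Proof.
move=> iZ [os ls ns] [ot lt nt] ox sx xt; split=> //.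
  by apply: le_trans lt _; apply: rworth_dom.
move=> l lZ li; apply: le_lt_trans (ns l lZ li); exact: rworth_dom.
Qed.

Definition chain_owner i (p : 'I_13) := exists s, s \in nth [::] chains p /\ owns i s.

Lemma two_owned i s t : i \in Z -> owns i s -> owns i t ->
  (s.1.1 != t.1.1) && (s.1.1 != t.1.2) && (s.1.1 != t.2) &&
  (s.1.2 != t.1.1) && (s.1.2 != t.1.2) && (s.1.2 != t.2) &&
  (s.2 != t.1.1) && (s.2 != t.1.2) && (s.2 != t.2) ->
  exists p q, [/\ p != q, chain_owner i p & chain_owner i q].
Proof.
move=> iZ.
have apart (x y : triple) : owns i x -> owns i y -> ~~ dom x y -> ~~ dom y x ->
    exists p q, [/\ p != q, chain_owner i p & chain_owner i q].
  move=> Ox Oy nxy nyx; have [[rx _ _] [ry _ _]] := conj Ox Oy.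
  have [p xp pC] := chain_cover rx; have [q yq _] := chain_cover ry.
  exists p, q; split; [|by exists x|by exists y].
  apply/negP=> /eqP E; rewrite -E in yq.
  by have := chain_dom pC xp yq; rewrite (negPf nxy) (negPf nyx).
have below (x y : triple) : owns i x -> owns i y -> dom x y ->
  (x.1.1 != y.1.1) && (x.1.1 != y.1.2) && (x.1.1 != y.2) &&
  (x.1.2 != y.1.1) && (x.1.2 != y.1.2) && (x.1.2 != y.2) &&
  (x.2 != y.1.1) && (x.2 != y.1.2) && (x.2 != y.2) ->
    exists p q, [/\ p != q, chain_owner i p & chain_owner i q].
  move=> Ox Oy xy nxy; have [[rx _ _] [ry _ _]] := conj Ox Oy.
  have [x' [y' [rx' ry' /andP[h1 h2] /andP[h3 h4] /andP[h5 h6]]]] := interval rx ry xy nxy.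
  by apply: (apart x' y') => //; [apply: owns_between Ox Oy _ _ _ | apply: owns_between Ox Oy _ _ _].
move=> Os Ot nst; have [dst|nd] := boolP (dom s t); first exact: below Os Ot dst nst.
have [dts|nd'] := boolP (dom t s); last exact: apart Os Ot nd nd'.
by apply: below Ot Os dts _; move: nst; rewrite ![_ == t.1.1]eq_sym ![_ == t.1.2]eq_sym ![_ == t.2]eq_sym; lia.
Qed.

Lemma owners_bound : (forall i, i \in Z -> exists p q, [/\ p != q, chain_owner i p & chain_owner i q]) ->
  #|Z| <= 6.
Proof.
move=> HZ; have /fin_all_exists[C HC] : forall i, exists C : {set 'I_13},
    (forall p, p \in C -> chain_owner i p) /\ (i \in Z -> 1 < #|C|).
  move=> i; have [iZ|_] := boolP (i \in Z); last by exists set0; split=> // p; rewrite inE.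
  have [p [q [pq Op Oq]]] := HZ i iZ; exists [set p; q]; split; last by rewrite cards2 pq.
  by move=> r; rewrite !inE => /orP[] /eqP->.
have : \sum_(i in Z) #|C i| <= 13.
  have -> : \sum_(i in Z) #|C i| = \sum_(p : 'I_13) \sum_(i in Z) (p \in C i).
    by rewrite exchange_big /=; apply: eq_bigr => i _; rewrite card_sum_mem.
  apply: leq_trans (_ : \sum_(p : 'I_13) 1 <= _); last by rewrite sum1_card card_ord.
  apply: leq_sum => p _.
  have [/existsP[i /andP[iZ pi]]|/existsPn no] := boolP [exists i, (i \in Z) && (p \in C i)]; last first.
    by rewrite big1 // => i iZ; have := no i; rewrite iZ; case: (_ \in _).
  rewrite (bigD1 i) //= big1 ?addn0 ?leq_b1 // => j /andP[jZ ji].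
  apply/eqP; rewrite eqb0; apply/negP=> pj.
  have [s [sp Os]] := (HC i).1 p pi; have [t [tp Ot]] := (HC j).1 p pj.
  have [rs _ _] := Os.
  have pC : nth [::] chains p \in chains by apply: mem_nth.
  have := chain_dom pC sp tp; rewrite (negPf (owns_apart jZ iZ ji Ot Os)) orbF.
  by apply/negP/(owns_apart iZ jZ _ Os Ot); rewrite eq_sym.
have : \sum_(i in Z) 2 <= \sum_(i in Z) #|C i| by apply: leq_sum => i iZ; apply: (HC i).2.
rewrite sum_nat_const; move: (\sum_(i in Z) _) => a; slia.
Qed.

End Ranks.

Lemma ex_ranks U : 0 < #|U| -> exists e : nat -> 'I_m,
  (forall a b, a <= b -> b < #|U| -> e a <= e b) /\ forall g, g \in U -> exists2 a, a < #|U| & e a = g.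
Proof.
case/card_gt0P=> g0 g0U; exists (nth g0 (enum U)).
have su : sorted (fun x y : 'I_m => x <= y) (enum U).
  apply: sorted_filter; first by move=> y x z; apply: leq_trans.
  by have := iota_sorted 0 m; rewrite -val_enum_ord sorted_map enumT.
split=> [a b ab bU|g gU].
  apply: (sorted_leq_nth (leT := fun x y : 'I_m => x <= y)) => //; rewrite ?inE -?cardE //.
  - by move=> y x z; apply: leq_trans.
  exact: leq_ltn_trans ab bU.
by exists (index g (enum U)); rewrite ?nth_index ?mem_enum // cardE index_mem mem_enum.
Qed.

Lemma triple_ranks U (e : nat -> 'I_m) (T : {set 'I_m}) : #|U| = 11 ->
  (forall a b, a <= b -> b < #|U| -> e a <= e b) -> (forall g, g \in U -> exists2 a, a < #|U| & e a = g) ->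
  T \subset U -> #|T| = 3 -> exists s, [/\ ranks_ok s, (forall l, worth l T = rworth e l s)
    & [/\ e s.1.1 \in T, e s.1.2 \in T & e s.2 \in T]].
Proof.
move=> cU em es sT cT.
have [x xT minx] := @ex_best T ltac:(slia).
have c2 : #|T :\ x| = 2 by have := cardsD1 x T; rewrite xT cT add1n => -[<-].
have [y yT miny] := @ex_best (T :\ x) ltac:(slia).
have /cards1P[z Ez] : #|T :\ x :\ y| == 1.
  by have := cardsD1 y (T :\ x); rewrite yT c2 add1n => -[<-].
have zT : z \in T :\ x :\ y by rewrite Ez inE.
have [yx yT'] : y != x /\ y \in T by move: yT; rewrite inE => /andP[]; rewrite inE.
have [zy zx zT'] : [/\ z != y, z != x & z \in T] by move: zT; rewrite !inE => /and3P[].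
have [[a a11 Ea] [b b11 Eb]] := conj (es x (subsetP sT x xT)) (es y (subsetP sT y yT')).
have [c c11 Ec] := es z (subsetP sT z zT').
have lt_rank p q : p < #|U| -> e q != e p -> e p <= e q -> p < q.
  move=> pU ne le; rewrite ltnNge; apply/negP=> qp; case/negP: ne; apply/eqP/val_inj.
  by apply/eqP; rewrite eqn_leq le em.
exists (a, b, c); split=> /=; last by rewrite Ea Eb Ec.
  rewrite /ranks_ok /= -cU c11 andbT; apply/andP; split; apply: lt_rank; rewrite ?Ea ?Eb ?Ec //.
    exact: minx.
  by apply: miny; rewrite !inE zx.
move=> l; rewrite /worth (big_setD1 x) //= (big_setD1 y) //= Ez big_set1 /rworth /= Ea Eb Ec.
by rewrite addrA.
Qed.

(* Seven agents would occupy fourteen different chains. *)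
Lemma owned_triples U (Z : {set I}) : #|U| = 11 -> (forall i, i \in Z -> exists S T : {set 'I_m},
    [/\ [/\ S \subset U, T \subset U & [disjoint S & T]], #|S| = 3 /\ #|T| = 3, likes i S /\ likes i T &
    forall l, l \in Z -> l != i -> ~~ likes l S /\ ~~ likes l T]) -> #|Z| <= 6.
Proof.
move=> cU HZ; have [e [em es]] := @ex_ranks U ltac:(slia).
have em' a b : a <= b -> b < 11 -> e a <= e b by rewrite -cU; apply: em.
apply: (owners_bound em') => i iZ.
have [S [T [[sS sT dST] [cS cT] [lS lT] no]]] := HZ i iZ.
have [s [rs ws [s1 s2 s3]]] := triple_ranks cU em es sS cS.
have [t [rt wt [t1 t2 t3]]] := triple_ranks cU em es sT cT.
have ne a b : e a \in S -> e b \in T -> a != b.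
  by move=> aS bT; apply: contraTneq bT => <-; rewrite (disjointFr dST aS).
apply: (two_owned em' iZ (s := s) (t := t)); rewrite ?ne //.
- split=> //; first by rewrite -ws.
  by move=> l lZ li; rewrite -ws dislikeE //; have [] := no l lZ li.
split=> //; first by rewrite -wt.
by move=> l lZ li; rewrite -wt dislikeE //; have [] := no l lZ li.
Qed.

(** * Four bundles and eleven goods *)

Lemma cards3_le (T : finType) (x y z : T) : #|[set x; y; z]| <= 3.
Proof. by rewrite setUC cardsU1 cards2; case: (_ \notin _); case: (_ != _). Qed.

Lemma split_six a b u d : 6 <= u -> u + d = a + b -> a <= 3 -> b <= 3 -> 3 <= a /\ d = 0.
Proof. lia. Qed.

Lemma three_of_eleven (n : 'I_3 -> nat) a : 11 = a + (n ord0 + n o1 + n o2) -> 1 < a ->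
  (forall c, 2 < n c) -> forall c, n c = 3.
Proof.
move=> E ha H; have := H ord0; have := H o1; have := H o2 => h2 h1 h0; apply: ord3P; lia.
Qed.

Lemma card_setD_ge (T : finType) (A B : {set T}) n k : #|B| <= k -> n + k <= #|A| -> n <= #|A :\: B|.
Proof.
rewrite cardsD; have := subset_leq_card (subsetIr A B).
move: #|A :&: B| #|A| #|B| => x y z; lia.
Qed.

(** The other goods of the bundle of [g] may join any of the three remaining bundles. So each of
    these is intact in some cut, has at least three goods as pairs are excluded, and exactly three
    by the total of eleven. *)
Lemma flexible i U g : g \in U -> #|U| = 11 -> nosingle i U -> cut i 4 U -> ~~ has_pair i (U :\ g) ->
  exists D : {set {set 'I_m}}, [/\ D \subset triples (U :\ g) i, trivIset D & #|D| = 3].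
Proof.
move=> gU cU nS /cutP[f Hf] np.
have ML (d : 'I_3) c : likes i (bun (merge f (f g) d) (U :\ g) c) by apply: merge_likes.
have ge3 c : 2 < #|bun f U (lift (f g) c)|.
  have [d [dc _ _]] := other3 c c.
  rewrite -(merge_bun (d := d) f gU) 1?eq_sym //.
  apply: (no_pair _ (ML d) np).
  by apply: nosingleS nS; apply: subsetDl.
have eq3 c : #|bun f U (lift (f g) c)| = 3.
  apply: (three_of_eleven (n := fun c => #|bun f U (lift (f g) c)|) _ (nosingle_size nS (bunS f U (f g)) (Hf _)) ge3).
  by rewrite -cU (card_bun f U) (bigD1_ord (f g)) //= sum3.
have [b|D [sD tD cD]] := @disjoint_triples 4 f i (U :\ g) (~: [set f g]).
  rewrite in_setC in_set1 => bg; rewrite eq_sym in bg; have [c Ec _] := unlift_some bg.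
  have [d [dc _ _]] := other3 c c.
  have Eb : bun f (U :\ g) b = bun (merge f (f g) d) (U :\ g) c.
    rewrite merge_bun 1?eq_sym // -Ec; apply/setP=> h; rewrite !inE.
    by have [->|] := eqVneq h g; rewrite //= gU (negPf bg).
  rewrite Eb; split; first by rewrite merge_bun 1?eq_sym.
  by apply: bun_triples => //; rewrite merge_bun 1?eq_sym.
by exists D; split=> //; rewrite cD; have := cardsC [set f g]; rewrite cards1 card_ord add1n => -[].
Qed.

Lemma other4 (p q : 'I_4) : exists a b : 'I_4, [/\ a != b, a != p, a != q, b != p & b != q].
Proof.
have : 1 < #|~: [set p; q]|.
  by have := cardsC [set p; q]; rewrite card_ord cards2; case: (p != q) => /=; lia.
case/card_gt1P=> a [b []]; rewrite !inE !negb_or => /andP[ap aq] /andP[bp bq] ab.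
by exists a, b.
Qed.

Lemma fourth (a b d e c : 'I_4) : a != b -> d != a -> d != b -> e != a -> e != b -> e != d ->
  c != a -> c != b -> c != d -> c = e.
Proof.
rewrite -!val_eqE /= => *; apply: val_inj => /=.
have := (ltn_ord a, ltn_ord b, ltn_ord c, (ltn_ord d, ltn_ord e)) => -[[[? ?] ?] [? ?]]; lia.
Qed.

Lemma inj4 (T : eqType) (a b d : 'I_4) (x y z w : T) : a != b -> d != a -> d != b ->
  x != y -> x != z -> x != w -> y != z -> y != w -> z != w ->
  injective (fun e => if e == a then x else if e == b then y else if e == d then z else w).
Proof.
move=> ab da db xy xz xw yz yw zw e e'.
have [ea|ea] := eqVneq e a; have [e'a|e'a] := eqVneq e' a;
have [eb|eb] := eqVneq e b; have [e'b|e'b] := eqVneq e' b;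
have [ed|ed] := eqVneq e d; have [e'd|e'd] := eqVneq e' d => E;
first [by rewrite ea e'a | by rewrite eb e'b | by rewrite ed e'd
  | by apply: (fourth ab da db)
  | by exfalso; move: xy xz xw yz yw zw; rewrite E eqxx ?andbF].
Qed.

(** * Eight agents, none of whom likes a single good *)

Section Four.
Variables (U : {set 'I_m}) (X : {set I}) (F : I -> {ffun 'I_m -> 'I_4}).
Hypotheses (cU : #|U| = 11) (cX : #|X| = 8) (unsolved : ~ solv 4 X U).
Hypothesis HF : forall i b, i \in X -> likes i (bun (F i) U b).
Hypothesis nS : forall i, i \in X -> nosingle i U.

Let cX4 : 4 < #|X|. Proof. by rewrite cX. Qed.

Let HX i : i \in X -> cut i 4 U.
Proof. by move=> iX; apply/cutP; exists (F i) => b; apply: HF. Qed.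

Definition paired i b := #|bun (F i) U b| == 2.

Definition onepair := [set i in X | #|pairs (F i) U| == 1].

(** Each of the eight agents has a pair and at most 3 * 3 pairs exist, so at most one agent has
    several. *)
Lemma onepair_big : 7 <= #|onepair|.
Proof.
have := pairs_bound solvable_nine cU cX4 HF unsolved solvable_nine.
have : \sum_(i in X) 2 <= \sum_(i in X) #|pairs (F i) U| + \sum_(i in X) (i \in onepair).
  rewrite -big_split; apply: leq_sum => i iX /=; rewrite inE iX /=.
  have := @pairs_lb 4 7 (F i) U cU (fun b => nosingle_size (nS iX) (bunS _ _ b) (HF b iX)).
  by case: #|pairs _ _| => [|[|n]] //=; lia.
have -> : \sum_(i in X) (i \in onepair) = #|onepair|.
  rewrite card_sum_mem big_mkcond /=; apply: eq_bigr => i _; rewrite inE.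
  by case: (i \in X).
rewrite sum_nat_const cX; move: (\sum_(i in X) _) #|_| => a b; lia.
Qed.

Lemma onepairP i : i \in onepair -> exists b0, paired i b0 /\
  forall b, b != b0 -> #|bun (F i) U b| = 3.
Proof.
rewrite inE => /andP[iX /cards1P[b0 E]].
have p0 : paired i b0 by have := set11 b0; rewrite -E inE.
exists b0; split=> // b bb0.
have ge3 c : c != b0 -> 2 < #|bun (F i) U c|.
  move=> cb; rewrite ltn_neqAle (nosingle_size (nS iX)) ?bunS ?HF // andbT eq_sym.
  by apply: contra cb => c2; rewrite -in_set1 -E inE.
have [a [a' [aa' ab ab0 a'b a'b0]]] := other4 b b0.
have := card_bun (F i) U; rewrite cU (bigD1 b0) //= (bigD1 b) //= (bigD1 a) ?ab0 ?ab //=.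
rewrite (bigD1 a') ?a'b ?a'b0 1?eq_sym //= => E11.
have := ge3 b bb0; have := ge3 a ab0; have := ge3 a' a'b0; move: E11; rewrite (eqP p0).
move: #|_| #|_| #|_| (\sum_(_ | _) _) => *; lia.
Qed.

(* Otherwise i keeps one of the two bundles left over, unless all the others dislike the pair of i. *)
Lemma exclusive i j k b0 a b : i \in X -> j \in X -> k \in X -> j != i -> k != i -> j != k ->
  paired i b0 -> a != b0 -> b != b0 -> a != b -> likes j (bun (F i) U a) ->
  likes k (bun (F i) U b) -> False.
Proof.
move=> iX jX kX ji ki jk p0 ab0 bb0 ab la lb; apply: unsolved.
pose W := X :\: [set i; j; k].
have cW : 4 < #|W|.
  by apply: (@card_setD_ge _ _ _ _ 3); rewrite ?cX ?cards3_le.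
have [/existsP[l /andP[lW ll]]|/existsPn no] := boolP [exists l, (l \in W) && likes l (bun (F i) U b0)].
  move: lW; rewrite !inE !negb_or => /andP[/andP[/andP[li lj] lk] lX].
  apply: (@solv_bun _ (F i) _ _ (fun e => if e == a then j else if e == b then k else
     if e == b0 then l else i)).
  - have [b0a b0b] : b0 != a /\ b0 != b by rewrite ![b0 == _]eq_sym.
    have [jl kl] : j != l /\ k != l by rewrite ![_ == l]eq_sym.
    exact: (inj4 ab b0a b0b jk jl ji kl ki li).
  - by move=> e; case: ifP => // _; case: ifP => // _; case: ifP.
  by move=> e; case: eqP => [->//|_]; case: eqP => [->//|_]; case: eqP => [->//|_]; apply: HF.
have sP : bun (F i) U b0 \subset U := bunS _ _ _.
apply: (solvable_give (W := W) solvable_nine _ sP iX (HF b0 iX)).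
- by have := cardsD U (bun (F i) U b0); rewrite (setIidPr sP) (eqP p0) cU.
- by apply/subsetP=> l; rewrite !inE !negb_or => /andP[/andP[/andP[-> _] _] ->].
- exact: ltnW.
move=> l lW; have lX : l \in X by move: lW; rewrite inE => /andP[].
apply: cut_dislike2; rewrite ?(eqP p0) //; first exact: HX.
by have := no l; rewrite lW.
Qed.

(** For an agent with one pair this leaves at least two triples that nobody else likes, as the
    chains require. *)
Definition sole i b0 := exists t, forall b j, b != b0 -> b != t -> j \in X -> j != i ->
  ~~ likes j (bun (F i) U b).

Definition rival i b0 j := [/\ j \in X, j != i,
  exists a b, [/\ a != b, a != b0, b != b0 & likes j (bun (F i) U a) /\ likes j (bun (F i) U b)] &
  forall l b, l \in X -> l != i -> l != j -> b != b0 -> ~~ likes l (bun (F i) U b)].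

(** By [exclusive], two other agents never like different bundles besides the pair. So if one agent
    likes two of these, nobody else likes any; if no agent does, only one such bundle is liked at
    all. *)
Lemma sole_or_rival i b0 : i \in X -> paired i b0 -> sole i b0 \/ exists j, rival i b0 j.
Proof.
move=> iX p0.
have [[j [a [b [jX ji [ab ab0 bb0] [la lb]]]]]|no2] := classic (exists j a b, [/\ j \in X, j != i,
    [/\ a != b, a != b0 & b != b0] & likes j (bun (F i) U a) /\ likes j (bun (F i) U b)]).
  right; exists j; split=> //; first by exists a, b.
  move=> l c lX li lj cb0; apply/negP=> lc.
  have [Ec|ca] := eqVneq c a.
    by subst c; apply: (@exclusive i j l b0 b a) => //; rewrite eq_sym.
  by apply: (@exclusive i j l b0 a c) => //; rewrite eq_sym.
left.
have [[j [a [jX ji ab0 la]]]|no1] := classic (exists j a, [/\ j \in X, j != i, a != b0 & likes j (bun (F i) U a)]).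
  exists a => b l bb0 ba lX li; apply/negP=> lb.
  have [Elj|lj] := eqVneq l j.
    by rewrite Elj in lb; rewrite eq_sym in ba; apply: no2; exists j, a, b; split.
  by apply: (@exclusive i j l b0 a b) => //; rewrite eq_sym.
by exists b0 => b j bb0 _ jX ji; apply/negP=> lb; apply: no1; exists j, b.
Qed.

Lemma cut_two i V Z : Z \subset V -> likes i Z -> likes i (V :\: Z) -> cut i 2 V.
Proof.
move=> sZ lZ lV; apply/cutP; exists [ffun x => if x \in Z then ord0 else ord_max] => b.
case: (unliftP ord0 b) => [c|] ->.
  apply: likesS lV; apply/subsetP=> x; rewrite !inE ffunE => /andP[/negPf-> ->] /=.
  by apply/eqP/val_inj; case: c => -[].
by apply: likesS lZ; apply/subsetP=> x xZ; rewrite inE ffunE xZ eqxx (subsetP sZ).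
Qed.

(* Otherwise l, or the part of U in the other two bundles, would be worth too little to l. *)
Lemma rival_inside i b0 j l e c : i \in X -> paired i b0 -> rival i b0 j -> l \in X -> l != i ->
  l != j -> c != b0 -> ~~ (bun (F l) U e \subset bun (F i) U b0 :|: bun (F i) U c).
Proof.
move=> iX p0 [jX ji [a' [b' [ab' ab0' bb0' [la' lb']]]] nol] lX li lj cb0; apply/negP=> sB.
have [a [ac ab0 la]] : exists a, [/\ a != c, a != b0 & likes j (bun (F i) U a)].
  by have [E|ac] := eqVneq a' c; [exists b'; rewrite -E eq_sym | exists a'].
have [b [bb0 bc ba]] : exists b, [/\ b != b0, b != c & b != a].
  have [x [y [xy x0 xc y0 yc]]] := other4 b0 c.
  by have [E|xa] := eqVneq x a; [exists y; split=> //; rewrite -E eq_sym | exists x].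
pose Ta := bun (F i) U a; pose Tb := bun (F i) U b; pose V := U :\: Ta :\: Tb.
have sTa : Ta \subset U := bunS _ _ _.
have sTb : Tb \subset U :\: Ta.
  apply/subsetP=> x; rewrite !inE => /andP[-> /eqP->]; by rewrite /= ba.
have Vl k : k \in X -> k != i -> k != j -> (2 < worth k V)%R.
  move=> kX ki kj; have := cut_worth (HX kX); rewrite /V !worthD //.
  have := dislikeE (nol k a kX ki kj ab0); have := dislikeE (nol k b kX ki kj bb0).
  rewrite -/Ta -/Tb; lra.
have sBV : bun (F l) U e \subset V.
  apply/subsetP=> x xB; have := subsetP sB x xB; rewrite !inE.
  case: (x \in U) => //= /orP[] /eqP->; rewrite ?andbT.
    by rewrite ![b0 == _]eq_sym (negPf ab0) (negPf bb0).
  by rewrite ![c == _]eq_sym (negPf ac) (negPf bc).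
have [cutl|ncut] := boolP (likes l (V :\: bun (F l) U e)).
  apply: unsolved; apply: (solv_give jX sTa la).
  have iX' : i \in X :\ j by rewrite !inE eq_sym ji.
  apply: (solv_give iX' sTb (HF b iX)).
  have [k kW] : exists k, k \in X :\: [set j; i; l].
    by apply/card_gt0P/(@card_setD_ge _ _ _ _ 3); rewrite ?cX ?cards3_le.
  have [kl ki kj kX] : [/\ k != l, k != i, k != j & k \in X].
    by move: kW; rewrite !inE !negb_or => /andP[/andP[/andP[-> ->] ->] ->].
  apply: (@solv2 _ _ l k); rewrite ?inE ?li ?lj ?ki ?kj //; first by rewrite eq_sym.
    exact: cut_two sBV (HF e lX) cutl.
  exact/ltW/Vl.
have cutB : cut l 3 (U :\: bun (F l) U e).
  by apply: (@cut_drop _ _ U _ (F l) e) => // d _; apply: HF.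
have sVB : U :\: bun (F l) U e \subset Ta :|: (Tb :|: (V :\: bun (F l) U e)).
  apply/subsetP=> x; rewrite !(in_setU, in_setD) => /andP[-> ->]; rewrite !andbT /=.
  by case: (x \in Ta); case: (x \in Tb).
have := le_trans (cut_worth cutB) (worthS l sVB).
have := worthU_le l Ta (Tb :|: (V :\: bun (F l) U e)); have := worthU_le l Tb (V :\: bun (F l) U e).
have := dislikeE ncut; have := dislikeE (nol l a lX li lj ab0); have := dislikeE (nol l b lX li lj bb0).
rewrite -/Ta -/Tb; lra.
Qed.

Lemma rival_pairs i b0 j l e x : i \in X -> paired i b0 -> rival i b0 j -> l \in X -> l != i ->
  l != j -> paired l e -> x \in bun (F l) U e -> x \in bun (F i) U b0 -> False.
Proof.
move=> iX p0 riv lX li lj pe xl xi.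
have /cards1P[y E] : #|bun (F l) U e :\ x| == 1.
  by have := cardsD1 x (bun (F l) U e); rewrite xl (eqP pe) add1n => -[<-].
have yl : y \in bun (F l) U e by have := set11 y; rewrite -E inE => /andP[].
have sub V : x \in V -> y \in V -> bun (F l) U e \subset V.
  move=> xV yV; apply/subsetP=> z zl; have [->//|zx] := eqVneq z x.
  have : z \in bun (F l) U e :\ x by rewrite in_setD1 zx zl.
  by rewrite E inE => /eqP->.
have [a [_ [_ ab0 _ _ _]]] := other4 b0 b0.
have [Ey|ny] := eqVneq (F i y) b0.
  have := rival_inside e iX p0 riv lX li lj ab0; apply/negP; rewrite negbK.
  apply: sub; rewrite in_setU; first by rewrite xi.
  by rewrite [y \in bun (F i) U b0]inE (subsetP (bunS _ _ _) y yl) Ey eqxx.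
have := rival_inside e iX p0 riv lX li lj ny; apply/negP; rewrite negbK.
apply: sub; rewrite in_setU ?xi //.
by rewrite [y \in bun (F i) U (F i y)]inE (subsetP (bunS _ _ _) y yl) eqxx orbT.
Qed.

(** The pairs of the six agents besides [i] and [j] avoid the top good [x0] in the pair of [i], so
    these agents lie in the classes of the two other top goods. A class has at most three members,
    so both are filled, without overlap, and nobody has two pairs. A rival of [l] is excluded
    because another member of its class has a pair meeting that of [l]. *)
Lemma rival_others i b0 j l : i \in X -> paired i b0 -> rival i b0 j -> l \in X -> l != i -> l != j ->
  l \in onepair /\ forall c k, paired l c -> ~ rival l c k.
Proof.
move=> iX p0 riv lX li lj; have [jX ji _ _] := riv.
have [//|[A [sA cA topA meetA]]] := pair_top solvable_nine cU cX4 HX.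
pose W := X :\ i :\ j.
have cW : #|W| = 6.
  have := cardsD1 i X; have := cardsD1 j (X :\ i); rewrite /W !inE jX ji iX cX /=.
  move: #|_| #|_| => *; lia.
have W_X k : k \in W -> [/\ k \in X, k != i & k != j] by rewrite !inE => /and3P[].
have [x0 x0P] : exists x, x \in bun (F i) U b0 :&: A.
  by apply/set0Pn/(meetA i); rewrite ?bunS ?HF //; apply/eqP.
move: x0P; rewrite inE => /andP[x0P x0A].
have /cards2P[x1 [x2 [x12 EA]]] : #|A :\ x0| == 2.
  by have := cardsD1 x0 A; rewrite x0A cA add1n => -[<-].
pose C x := class U X F x.
have top k e : k \in W -> paired k e -> exists x, [/\ x \in [set x1; x2], k \in C x & x \in bun (F k) U e].
  move=> /W_X[kX ki kj] pe.
  have pK : e \in pairs (F k) U by rewrite inE.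
  have [x [xA xC xe]] := pair_class (r := 2) (c := 6) cU cX4 HF meetA topA kX pK.
  exists x; split=> //; rewrite -EA in_setD1 xA andbT.
  by apply/negP=> /eqP E; rewrite E in xe; apply: (rival_pairs iX p0 riv kX ki kj pe xe x0P).
have haspair k : k \in X -> exists e, paired k e.
  move=> kX; have := @pairs_lb 4 7 (F k) U cU (fun b => nosingle_size (nS kX) (bunS _ _ b) (HF b kX)).
  have [E0|] := posnP #|pairs (F k) U|; first by rewrite E0.
  by case/card_gt0P=> e; rewrite inE => pe _; exists e.
have cC x : #|C x| <= 3 := class_bound solvable_nine cU cX4 HF unsolved x solvable_nine.
have WC x y : x \in [set x1; x2] -> [set x1; x2] = [set x; y] -> 3 <= #|W :&: C x| /\ W :&: C x :&: C y = set0.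
  move=> _ Exy.
  have sW : W \subset (W :&: C x) :|: (W :&: C y).
    apply/subsetP=> k kW; have [kX _ _] := W_X k kW; have [e pe] := haspair k kX.
    have [z [zx kz _]] := top k e kW pe; move: zx; rewrite Exy !in_setU !in_setI kW !in_set1.
    by case/orP=> /eqP E; rewrite E in kz; rewrite kz ?orbT.
  have c1 := subset_leq_card (subsetIr W (C x)); have c2 := subset_leq_card (subsetIr W (C y)).
  have := subset_leq_card sW; have := cardsUI (W :&: C x) (W :&: C y).
  have := cC x; have := cC y; rewrite cW => h1 h2 h3 h4.
  have l1 := leq_trans c1 h2; have l2 := leq_trans c2 h1.
  have [ge3 I0] : 3 <= #|W :&: C x| /\ #|W :&: C x :&: (W :&: C y)| = 0.
    exact: (split_six h4 h3 l1 l2).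
  split=> //; apply/eqP; rewrite -cards_eq0 -I0 setIACA setIid setIA; exact/eqP.
have two x : x \in [set x1; x2] -> exists y, [set x1; x2] = [set x; y].
  by rewrite !inE => /orP[] /eqP->; [exists x2 | exists x1; rewrite setUC].
have lW : l \in W by rewrite !inE lX li lj.
have [e pe] := haspair l lX; have [x [xA lx xe]] := top l e lW pe.
have [y Exy] := two x xA; have [ge3 I0] := WC x y xA Exy.
have uniq_pair e' : paired l e' -> e' = e.
  move=> pe'; have [z [zA lz ze]] := top l e' lW pe'.
  move: xe ze; rewrite !inE => /andP[_ /eqP <-] /andP[_ /eqP <-].
  move: zA; rewrite Exy !inE => /orP[] /eqP E; subst z => //.
  by have := in_set0 l; rewrite -I0 !in_setI lW lx lz.
split.
  rewrite inE lX; apply/cards1P; exists e; apply/setP=> e'; rewrite !inE.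
  by apply/idP/eqP=> [/uniq_pair//|->].
move=> c k pc rk; have := uniq_pair c pc => Ec; subst c.
have [l' l'D] : exists l', l' \in (W :&: C x) :\: [set l; k].
  by apply/card_gt0P/(@card_setD_ge _ _ _ _ 2) => //; rewrite cards2; case: (_ != _).
move: l'D; rewrite in_setD in_set2 negb_or in_setI => /andP[/andP[l'l l'k] /andP[l'W l'x]].
have [l'X _ _] := W_X l' l'W.
move: l'x; rewrite inE => /existsP[z /and3P[_ xz /existsP[d /eqP Ed]]].
apply: (rival_pairs (x := x) lX pe rk l'X l'l l'k (e := d)) => //.
  by move: xz; rewrite /paired Ed cards2 ltn_neqAle => /andP[+ _]; rewrite -val_eqE => ->.
by rewrite Ed !inE eqxx.
Qed.

Lemma four_unsolved : False.
Proof.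
suff [Z [cZ HZ]] : exists Z : {set I}, 6 < #|Z| /\ forall i, i \in Z -> exists S T : {set 'I_m},
    [/\ [/\ S \subset U, T \subset U & [disjoint S & T]], #|S| = 3 /\ #|T| = 3, likes i S /\ likes i T &
    forall l, l \in Z -> l != i -> ~~ likes l S /\ ~~ likes l T].
  by have := owned_triples cU HZ; rewrite leqNgt cZ.
have pick i b0 (Z : {set I}) t : i \in X -> (forall b, b != b0 -> #|bun (F i) U b| = 3) ->
    (forall b l, b != b0 -> b != t -> l \in Z -> l != i -> ~~ likes l (bun (F i) U b)) ->
    exists S T : {set 'I_m}, [/\ [/\ S \subset U, T \subset U & [disjoint S & T]],
      #|S| = 3 /\ #|T| = 3, likes i S /\ likes i T &
      forall l, l \in Z -> l != i -> ~~ likes l S /\ ~~ likes l T].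
  move=> iX c3 no; have [a [b [ab a0 at' b0' bt]]] := other4 b0 t.
  exists (bun (F i) U a), (bun (F i) U b); split; first by rewrite !bunS bun_disj.
  - by rewrite !c3.
  - by rewrite !HF.
  by move=> l lZ li; split; apply: no.
(* If a rival [j] exists, all agents but [j] qualify: [i] because only [j] likes its triples, the
   others by [rival_others]. Otherwise the agents with exactly one pair qualify. *)
have [[i [b0 [j [iY p0 riv]]]]|none] := classic (exists i b0 j, [/\ i \in onepair, paired i b0 & rival i b0 j]).
  have iX : i \in X by move: iY; rewrite inE => /andP[].
  have [jX ji _ no] := riv; exists (X :\ j); split; first by have := cardsD1 j X; rewrite jX cX; lia.
  move=> l; rewrite in_setD1 => /andP[lj lX].
  have [->|li] := eqVneq l i.
    have [c [pc c3]] := onepairP iY.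
    have Ec : c = b0 by apply/eqP; apply: contraTT p0 => cb; rewrite /paired c3 // eq_sym.
    apply: (pick i b0 _ b0) => //; first by rewrite -Ec.
    by move=> b k bb0 _; rewrite in_setD1 => /andP[kj kX] ki; apply: no.
  have [lY nr] := rival_others iX p0 riv lX li lj.
  have [c [pc c3]] := onepairP lY.
  have [[t Ht]|[k rk]] := sole_or_rival lX pc; last by case: (nr c k pc).
  by apply: (pick l c _ t) => // b k bc bt /setD1P[_ kX] kl; apply: Ht.
exists onepair; split; first exact: onepair_big.
move=> l lY; have lX : l \in X by move: lY; rewrite inE => /andP[].
have [c [pc c3]] := onepairP lY.
have [[t Ht]|[k rk]] := sole_or_rival lX pc; last by case: none; exists l, c, k.
apply: (pick l c _ t) => // b k bc bt kY kl; apply: Ht => //.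
by move: kY; rewrite inE => /andP[].
Qed.

End Four.

(** * Induction on the number of bundles *)

Lemma solvable_sub r N c : (forall U X, #|U| = r + c -> #|X| = N -> (forall i, i \in X -> cut i r U) ->
  solv r X U) -> solvable r N c.
Proof.
move=> H U X cU cX HX; have [Y sY cY] := ex_subset cX.
apply: (solvS _ sY (subxx U)); apply: H cU cY _ => i /(subsetP sY); exact: HX.
Qed.

Lemma likers g U X : (exists2 l, l \in X & likes l [set g]) \/ forall i, i \in X -> ~~ likes i [set g].
Proof.
have [/existsP[l /andP[lX lg]]|/existsPn nS] := boolP [exists l, (l \in X) && likes l [set g]].
  by left; exists l.
by right=> i iX; have := nS i; rewrite iX.
Qed.

(** Once [l] has [g], at most one agent owns a pair. Of the others, at least six, all have two
    disjoint triples, and those who disliked [g], at least four, have three: 6 * 2 + 4 = 16 exceeds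
    13. *)
Lemma four_few U X g l : #|U| = 11 -> #|X| = 8 -> (forall i, i \in X -> cut i 4 U) -> g \in U ->
  (forall h, h \in U -> g <= h) -> #|[set i in X | likes i [set g]]| <= 3 -> l \in X ->
  likes l [set g] -> solv 4 X U.
Proof.
move=> cU cX HX gU best; set S := [set i in X | _] => cS lX lg; apply: NNPP => ns.
have ns3 : ~ solv 3 (X :\ l) (U :\ g).
  by move=> s; apply: ns; apply: (solv_give lX _ lg s); rewrite sub1set.
have cX7 : #|X :\ l| = 7 by have := cardsD1 l X; rewrite lX cX => -[].
have cX3 : 2 < #|X :\ l| by rewrite cX7.
have cU10 : #|U :\ g| = 10 by have := cardsD1 g U; rewrite gU cU => -[].
have cU3 : 3 < #|U :\ g| by rewrite cU10.
have HX3 i : i \in X :\ l -> cut i 3 (U :\ g).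
  by rewrite inE => /andP[_ /HX]; apply: cut_single.
have nS i : i \in X :\ l -> nosingle i (U :\ g) := unsolved_nosingle (c := 7) ns3 cU10 cX3 HX3.
have := pair_agents ns3 cX3 cU3 HX3; set H := [set i in X :\ l | _] => pa.
have sS : S \subset X by apply/subsetP=> i; rewrite inE => /andP[].
have lS : l \in S by rewrite inE lX.
have /fin_all_exists[D HD] : forall i, exists D : {set {set 'I_m}},
    i \in X :\ l -> D \subset triples (U :\ g) i /\ trivIset D /\ (i \notin H -> 2 + (i \notin S) <= #|D|).
  move=> i; have [iX|] := boolP (i \in X :\ l); last by exists set0.
  have [iH|iH] := boolP (i \in H).
    by exists set0 => _; rewrite sub0set; split=> //; split=> //; apply/trivIsetP=> T; rewrite inE.
  have np : ~~ has_pair i (U :\ g) by move: iH; rewrite inE iX.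
  have [iS|iS] := boolP (i \in S).
    by have [D [sD tD cD]] := two_triples (nS i iX) cU10 (HX3 i iX) np; exists D.
  have iX' : i \in X by move: iX; rewrite inE => /andP[].
  have nSi : nosingle i U by rewrite (nosingle_best i gU best); move: iS; rewrite inE iX'.
  have [D [sD tD cD]] := flexible gU cU nSi (HX i iX') np.
  by exists D => _; rewrite cD.
have HD' i : i \in X :\ l -> D i \subset triples (U :\ g) i /\ trivIset (D i) by case/HD=> ? [].
have := triples_bound ns3 cX3 HX3 cU10 HD'; apply/negP; rewrite -ltnNge.
have sH : H \subset X :\ l by apply/subsetP=> i; rewrite inE => /andP[].
have cY : 6 <= #|X :\ l :\: H|.
  have := cardsD (X :\ l) H; rewrite (setIidPr sH) cX7.
  move: pa; move: #|_| #|_ :\: _| => a b; lia.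
have cZ : 4 <= #|(X :\ l :\: H) :\: S|.
  have : #|(X :\ l :\: H) :&: S| <= 2.
    apply: leq_trans (_ : #|S :\ l| <= _); last by have := cardsD1 l S; rewrite lS; slia.
    by apply: subset_leq_card; apply/subsetP=> i; rewrite !inE => /andP[/and3P[_ -> _] ->].
  have := cardsID S (X :\ l :\: H); move: cY; move: #|_| #|_ :&: _| #|_ :\: S| => a b d; lia.
apply: leq_trans (_ : \sum_(i in X :\ l :\: H) (2 + (i \notin S)) <= _).
  rewrite big_split /= sum_nat_const (_ : \sum_(i in _) _ = #|(X :\ l :\: H) :\: S|).
    by move: cY cZ; move: #|_| #|_ :\: S| => a b; lia.
  rewrite card_sum_mem big_mkcond /=; apply: eq_bigr => i _; rewrite [in RHS]inE.
  by case: (i \in S); case: (i \in _ :\: H).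
rewrite [leqRHS](big_setID H) /=; apply: leq_trans (leq_addl _ _).
by apply: leq_sum => i /setDP[iX iH]; have [_ [_ ->]] := HD i iX.
Qed.

Lemma solvable_4_8_7 : solvable 4 8 7.
Proof.
apply: solvable_sub => U X cU cX HX.
have [g gU best] := @ex_best U ltac:(slia).
have [many|few] := ltnP 3 #|[set i in X | likes i [set g]]|.
  apply: (single_many solvable_ten cU _ HX gU _ many); first by rewrite cX.
    by apply/subsetP=> i; rewrite inE => /andP[].
  by move=> i; rewrite inE => /andP[].
have [[l lX lg]|no] := likers g U X; first exact: four_few cU cX HX gU best few lX lg.
apply: NNPP => ns; have [F HF] := ex_cuts HX.
apply: (four_unsolved cU cX ns HF) => i iX.
by rewrite (nosingle_best i gU best) no.
Qed.

Lemma pairs_contra r N c n U X : solvable r.+1 N c -> solvable r.+1 n.+1 c -> #|U| = r.+3 + c ->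
  N < #|X| -> (forall i, i \in X -> cut i r.+2 U) -> (forall i, i \in X -> nosingle i U) ->
  r.+1 * n < #|X| * (2 * r.+2 - c.+1) -> solv r.+2 X U.
Proof.
move=> H1 H2 cU cX HX nS lt; apply: NNPP => ns; have [F HF] := ex_cuts HX.
have := pairs_bound H1 cU cX HF ns H2; apply/negP; rewrite -ltnNge; apply: leq_trans lt _.
rewrite -sum_nat_const; apply: leq_sum => i iX; rewrite leq_subLR addnC.
apply: pairs_lb => [|b]; first by rewrite cU addnS.
by apply: (nosingle_size (nS i iX)); rewrite ?bunS ?HF.
Qed.

(* The agents in D dislike every good, so that they remain while goods are given away singly. *)
Lemma five_mostly U X (D : {set I}) : #|U| = 12 -> 6 < #|X| -> (forall i, i \in X -> cut i 5 U) ->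
  D \subset X -> 2 < #|D| -> (forall i, i \in D -> nosingle i U /\ mostly 1 5 i U) -> solv 5 X U.
Proof.
move=> cU cX HX sD cD HD.
have [[g [l [gU lX lg]]]|nS] := @no_best 8 3 U X cU; last first.
  apply: (pairs_contra solvable_4_5_6 solvable_4_5_6 cU _ HX nS); first exact: ltnW.
  by move: cX; move: #|X| => a; lia.
have sD' : D \subset X :\ l.
  apply/subsetP=> i iD; rewrite !inE (subsetP sD) // andbT.
  exact: likes_nosingle gU lg (HD i iD).1.
apply: (solv_give lX _ lg); first by rewrite sub1set.
have cX' := cardsD1 l X; rewrite lX in cX'.
apply: (solv_mostly (t := 1) (D := D)) => //.
- by have := cardsD1 g U; rewrite gU cU => -[].
- by move: cX cX'; move: #|_| #|_| => *; lia.
- by move=> i; rewrite inE => /andP[_ /HX]; apply: cut_single.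
- by apply: leq_trans cD.
- by move: cX cX' cD; move: #|_| #|_| #|_| => *; lia.
move=> i iD; have [ni mi] := HD i iD; split; last exact: mostly_peel.
by apply: nosingleS ni; apply: subsetDl.
Qed.

Lemma solvable_by_likers r : r < 5 -> solvable r.+3 8 7 -> (forall U X g l, #|U| = r.+4 + 7 -> #|X| = 8 ->
    (forall i, i \in X -> cut i r.+4 U) -> g \in U -> l \in X -> likes l [set g] ->
    #|[set i in X | nosingle i U]| > 4 - r -> solv r.+4 X U) ->
  (forall U X, #|U| = r.+4 + 7 -> #|X| = 8 -> (forall i, i \in X -> cut i r.+4 U) ->
    (forall i, i \in X -> nosingle i U) -> solv r.+4 X U) ->
  solvable r.+4 8 7.
Proof.
move=> r5 H few none; apply: solvable_sub => U X cU cX HX.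
have [g gU best] := @ex_best U ltac:(slia).
have ES : [set i in X | nosingle i U] = X :\: [set i in X | likes i [set g]].
  by apply/setP=> i; rewrite !inE (nosingle_best i gU best); case: (i \in X); rewrite ?andbT.
have sS : [set i in X | likes i [set g]] \subset X by apply/subsetP=> i; rewrite inE => /andP[].
have [many|le] := ltnP r.+3 #|[set i in X | likes i [set g]]|.
  apply: (single_many H cU _ HX gU sS many); first by rewrite cX.
  by move=> i; rewrite inE => /andP[].
have [[l lX lg]|no] := likers g U X.
  apply: (few U X g l) => //; rewrite ES cardsD (setIidPr sS) cX.
  by move: le r5; move: #|_| => a; lia.
by apply: none => // i iX; rewrite (nosingle_best i gU best) no.
Qed.

Lemma solvable_5_8_7 : solvable 5 8 7.
Proof.
apply: (@solvable_by_likers 1 isT solvable_4_8_7) => [U X g l cU cX HX gU lX lg cD|U X cU cX HX nS]; last first.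
  by apply: (pairs_contra solvable_4_5_6 solvable_4_5_6 cU _ HX nS); rewrite cX.
set D := [set i in X | nosingle i U] in cD.
have DP i : i \in D -> i \in X /\ nosingle i U by rewrite inE => /andP.
apply: (solv_give lX _ lg); first by rewrite sub1set.
have cX' := cardsD1 l X; rewrite lX cX in cX'.
(* Twelve goods in five bundles of size at least two leave at most two that are not pairs. [D] has
   at least four agents, and 7 + 4 * 1 exceeds 9. *)
apply: (solv_mostly (t := 2) (D := D)) => //.
- by have := cardsD1 g U; rewrite gU cU => -[].
- by move: cX'; move: #|_| => *; lia.
- by move=> i; rewrite inE => /andP[_ /HX]; apply: cut_single.
- apply/subsetP=> i /DP[iX ni]; rewrite !inE iX andbT.
  exact: likes_nosingle gU lg ni.
- by move: cD; move: #|_| => *; lia.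
- by move: cX' cD; move: #|_| #|_| => *; lia.
move=> i /DP[iX ni]; split; first by apply: nosingleS ni; apply: subsetDl.
by apply: mostly_peel => //; apply: nosingle_mostly => //; apply: HX.
Qed.

Lemma solvable_6_8_7 : solvable 6 8 7.
Proof.
apply: (@solvable_by_likers 2 isT solvable_5_8_7) => [U X g l cU cX HX gU lX lg cD|U X cU cX HX nS]; last first.
  by apply: (pairs_contra solvable_5_6_6 solvable_5_6_6 cU _ HX nS); rewrite cX.
set D := [set i in X | nosingle i U] in cD.
have DP i : i \in D -> i \in X /\ nosingle i U by rewrite inE => /andP.
apply: (solv_give lX _ lg); first by rewrite sub1set.
have cX' := cardsD1 l X; rewrite lX cX in cX'.
(* Thirteen goods in six bundles leave at most one that is not a pair, and [D] has at least three
   agents. *)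
apply: (five_mostly (D := D)) => //.
- by have := cardsD1 g U; rewrite gU cU => -[].
- by move: cX'; move: #|_| => *; lia.
- by move=> i; rewrite inE => /andP[_ /HX]; apply: cut_single.
- apply/subsetP=> i /DP[iX ni]; rewrite !inE iX andbT.
  exact: likes_nosingle gU lg ni.
move=> i /DP[iX ni]; split; first by apply: nosingleS ni; apply: subsetDl.
by apply: mostly_peel => //; apply: nosingle_mostly => //; apply: HX.
Qed.

Lemma solvable_all_like r N c : solvable r.+1 N c -> (forall U X i, #|U| = r.+2 + c -> r.+2 <= #|X| ->
    N <= #|X| -> (forall i, i \in X -> cut i r.+2 U) -> i \in X -> nosingle i U -> solv r.+2 X U) ->
  solvable r.+2 (maxn N r.+2) c.
Proof.
move=> H no U X cU; rewrite geq_max => /andP[cN cX] HX.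
have [g gU best] := @ex_best U ltac:(slia).
have [/existsP[i /andP[iX ni]]|/existsPn all_like] := boolP [exists i, (i \in X) && nosingle i U].
  exact: no ni.
apply: (single_many H cU cN HX gU (subxx X) cX) => l lX.
by have := all_like l; rewrite lX (nosingle_best l gU best) negbK.
Qed.

(** An agent disliking every single good would split fourteen goods into seven pairs, each
    containing one of only six best goods. So either the instance is solved by a pair, or all agents
    like the best good and it can be set aside. *)
Lemma solvable_7_8_7 : solvable 7 8 7.
Proof.
apply: (solvable_all_like solvable_6_8_7) => U X i cU _ cX HX iX ni.
have [//|[A [sA cA topA meetA]]] := pair_top solvable_6_7_6 cU cX HX.
have /cutP[f Hf] := HX i iX.
have := @pairs_lb 7 7 f U cU (fun b => nosingle_size ni (bunS _ _ b) (Hf b)).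
have : #|pairs f U| <= #|A|.
  apply: leq_trans (leq_imset_card f _); apply: subset_leq_card; apply/subsetP=> b.
  rewrite inE => cb; have /set0Pn[x] : bun f U b :&: A != set0.
    by apply: (meetA i); rewrite ?bunS //; apply/eqP.
  rewrite !inE => /andP[/andP[_ /eqP fx] xA].
  by apply/imsetP; exists x.
rewrite cA; move: #|_| => a; lia.
Qed.

(** From eight bundles on there are fewer than two goods per bundle, so each agent likes a single
    good, hence the best one. *)
Lemma solvable_main n : 7 <= n -> solvable n (maxn 8 n) 7.
Proof.
move/subnKC<-; elim: (n - 7) => [|k IH]; first exact: solvable_7_8_7.
rewrite addnS (_ : maxn 8 (7 + k).+1 = maxn (maxn 8 (7 + k)) (7 + k).+1); last by lia.
apply: (@solvable_all_like (6 + k) _ _ IH) => U X i cU cX8 _ HX iX ni.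
have /cutP[f Hf] := HX i iX.
have : \sum_(b < (6 + k).+2) 2 <= \sum_(b < (6 + k).+2) #|bun f U b|.
  by apply: leq_sum => b _; apply: nosingle_size ni (bunS _ _ b) (Hf b).
rewrite -card_bun cU sum_nat_const card_ord => le; exfalso; move: le; lia.
Qed.

End Allocations.

(** * Reduction to identical rankings *)

Lemma sorting_perm (R : realFieldType) m (u : 'I_m -> R) :
  exists p : {perm 'I_m}, forall a b : 'I_m, a <= b -> (u (p b) <= u (p a))%R.
Proof.
pose geu (x y : 'I_m) := (u y <= u x)%R.
have tr : transitive geu by move=> y x z xy yz; apply: le_trans yz xy.
have tot : total geu by move=> x y; apply: le_total.
pose s := sort geu (enum 'I_m).
have sz : size s = m by rewrite size_sort size_enum_ord.
have un : uniq s by rewrite sort_uniq enum_uniq.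
have inj : injective (fun k : 'I_m => nth k s k).
  move=> a b; rewrite (set_nth_default b) ?sz // => /eqP.
  by rewrite nth_uniq ?sz // => /eqP/val_inj.
exists (perm inj) => a b ab; rewrite !permE (set_nth_default b a) ?sz //.
apply: (sorted_leq_nth tr _ b (sort_sorted tot _)) => //; rewrite ?inE ?sz //.
by move=> x; apply: lexx.
Qed.

(* Bouveret and Lemaitre: at step k the agent a k takes a good that is at least as good for him
   as his (k+1)-st best good, since only k goods are gone. *)
Lemma picking_sequence (R : realFieldType) n m (v : 'I_n -> 'I_m -> R) (a : 'I_m -> 'I_n)
    (p : 'I_n -> {perm 'I_m}) :
  (forall i (x y : 'I_m), x <= y -> (v i (p i y) <= v i (p i x))%R) ->
  exists2 c : 'I_m -> 'I_m, injective c & forall x, (v (a x) (p (a x) x) <= v (a x) (c x))%R.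
Proof.
move=> Hp.
suff H k : k <= m -> exists c : 'I_m -> 'I_m,
    (forall x y : 'I_m, x < k -> y < k -> c x = c y -> x = y) /\
    forall x : 'I_m, x < k -> (v (a x) (p (a x) x) <= v (a x) (c x))%R.
  by have [c [c_inj Hc]] := H m (leqnn m); exists c => [x y|x]; [apply: c_inj | apply: Hc].
elim: k => [|k IH] km; first by exists id.
have [c [c_inj Hc]] := IH (ltnW km); pose x0 := Ordinal km; pose i := a x0.
have /subsetPn[g /imsetP[y y0 ->] gc] :
    ~~ ([set p i y | y in [set y : 'I_m | y <= k]] \subset [set c x | x in [set x : 'I_m | x < k]]).
  apply/negP=> /subset_leq_card; rewrite card_imset; last exact: perm_inj.
  apply/negP; rewrite -ltnNge; apply: leq_ltn_trans (leq_imset_card _ _) _.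
  apply: proper_card; apply/properP; split.
    by apply/subsetP=> x; rewrite !inE => /ltnW.
  by exists x0; rewrite inE ?leqnn // ltnn.
have ne (x : 'I_m) : x < k -> c x != p i y.
  by move=> xk; apply: contraNneq gc => <-; apply/imsetP; exists x; rewrite ?inE.
exists (fun x => if x == x0 then p i y else c x); split=> [x z|x].
  rewrite !ltnS => xk zk; case: eqP => [->|xx]; case: eqP => [->//|zz] E.
  - have zk' : z < k by rewrite ltn_neqAle zk andbT; apply/eqP=> h; apply: zz; apply: val_inj.
    by have := ne z zk'; rewrite E eqxx.
  - have xk' : x < k by rewrite ltn_neqAle xk andbT; apply/eqP=> h; apply: xx; apply: val_inj.
    by have := ne x xk'; rewrite E eqxx.
  apply: c_inj E; rewrite ltn_neqAle ?xk ?zk andbT; apply/eqP=> h; [apply: xx | apply: zz];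
    exact: val_inj.
rewrite ltnS => xk; case: eqP => [->|xx]; first by apply: Hp; move: y0; rewrite inE.
by apply: Hc; rewrite ltn_neqAle xk andbT; apply/eqP=> h; apply: xx; apply: val_inj.
Qed.

Lemma bundles_worth_one (R : realFieldType) (n m : nat) (v : 'I_n -> 'I_m -> R) :
  8 <= n -> m = n + 7 -> (forall i g, (0 <= v i g)%R) ->
  (forall i, exists A : {ffun 'I_m -> 'I_n}, forall j, (1 <= \sum_(g in bundle A j) v i g)%R) ->
  exists A : {ffun 'I_m -> 'I_n}, forall i, (1 <= \sum_(g in bundle A i) v i g)%R.
Proof.
move=> n8 mn v0 HA.
have /fin_all_exists[p Hp] := fun i => sorting_perm (v i).
(* [w i] lists the values of agent [i] in decreasing order, so that all agents rank the positions
   alike. *)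
pose w i x := v i (p i x).
have cU : #|[set: 'I_m]| = n + 7 by rewrite cardsT card_ord.
have cX : maxn 8 n <= #|[set: 'I_n]| by rewrite cardsT card_ord geq_max n8 leqnn.
have sol : solvable w n (maxn 8 n) 7.
  by apply: solvable_main => [i g|i x y|]; [apply: v0 | apply: Hp | apply: ltnW].
have [|B [a [_ cB HB]]] := sol setT setT cU cX.
  move=> i _; have [A Ai] := HA i; pose f := [ffun x => A (p i x)].
  suff Hf j : likes w i (bun f setT j) by apply/existsP; exists f; apply/forallP.
  rewrite /likes /worth (le_trans (Ai j)) //.
  rewrite (reindex_inj (perm_inj (s := p i))) /= le_eqVlt; apply/orP; left; apply/eqP.
  by apply: eq_bigl => x; rewrite !inE ffunE.
have BT i : i \in B.
  have /eqP -> : B == setT by rewrite eqEcard subsetT cB cardsT card_ord /=.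
  by rewrite inE.
have [c c_inj Hc] := picking_sequence a Hp.
have [c' cK c'K] := injF_bij c_inj.
exists [ffun g => a (c' g)] => i; apply: le_trans (HB i (BT i)) _.
rewrite /worth [leRHS](reindex_inj c_inj) /= [leRHS](eq_bigl (fun x => a x == i)); last first.
  by move=> x; rewrite !inE ffunE cK.
rewrite (eq_bigl (fun x => a x == i)); last by move=> x; rewrite !inE.
by apply: ler_sum => x /eqP <-; apply: Hc.
Qed.

(** The maximum is either attained by an allocation or equal to the seed 0, for which any allocation
    will do. *)
Lemma ex_maximin (R : realFieldType) (n m : nat) (v : 'I_n -> 'I_m -> R) (i : 'I_n) :
  (forall g, (0 <= v i g)%R) ->
  exists A : {ffun 'I_m -> 'I_n}, forall j, (mms v i <= \sum_(g in bundle A j) v i g)%R.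
Proof.
move=> v0; apply: (big_ind (fun r => exists A : {ffun 'I_m -> 'I_n}, forall j,
  (r <= \sum_(g in bundle A j) v i g)%R)) => [|x y [A HA] [B HB]|A _].
- by exists [ffun=> i] => j; apply: sumr_ge0.
- by case: (leP x y) => _; [exists B | exists A].
by exists A => j; apply: bigmin_le_cond.
Qed.

Local Open Scope ring_scope.

Theorem theorem3 (R : realFieldType) (n m : nat) (v : 'I_n -> 'I_m -> R) :
  (8 <= n)%N -> m = (n + 7)%N ->
  (forall (i : 'I_n) (g : 'I_m), 0 <= v i g) ->
  exists A : {ffun 'I_m -> 'I_n}, is_MMS_allocation v A.
Proof.
move=> n8 mn v0.
have mu0 i : (0 <= mms v i)%R := bigmax_ge_id _ _ _ _.
(* Agents with maximin share 0 need nothing and may be given the constant valuation 1. *)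
pose w i g := if mms v i == 0%R then 1%R else (v i g / mms v i)%R.
have w0 i g : (0 <= w i g)%R by rewrite /w; case: eqP => _ //; rewrite divr_ge0.
have [i|A HA] := bundles_worth_one n8 mn w0.
  rewrite /w; have [E|mu] := eqVneq (mms v i) 0%R.
    have n_gt0 : (0 < n)%N by apply: leq_trans n8.
    (* Since there are at least [n] goods, dealing them out modulo [n] puts good [j] into bundle
       [j]. *)
    exists [ffun g : 'I_m => Ordinal (ltn_pmod g n_gt0)] => j.
    have jm : (j < m)%N by rewrite mn ltn_addr.
    rewrite (bigD1 (Ordinal jm)) /=; last first.
      by rewrite inE ffunE; apply/eqP/val_inj; rewrite /= modn_small.
    by rewrite lerDl sumr_ge0.
  have [A HA] := ex_maximin (v0 i); exists A => j.
  by rewrite -mulr_suml ler_pdivlMr ?mul1r // lt_neqAle eq_sym mu mu0.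
exists A => i; have := HA i; rewrite /w; have [->|mu] := eqVneq (mms v i) 0%R.
  by move=> _; apply: sumr_ge0.
by rewrite -mulr_suml ler_pdivlMr ?mul1r // lt_neqAle eq_sym mu mu0.
Qed.
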